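(* Fix $k \in \mathbb{Z}_{+}$ and $\overline{n} = (n_1,\ldots,n_k) \in \mathbb{Z}_{+}^{k}$. Given a Presburger formula $F \in \mathrm{PA}_{k,\overline{n}}$, there exists a decomposition (of the set of integer points $\mathbf{x}_1 \in \mathbb{Z}^{n_1}$ satisfying $F$) $$F = \bigsqcup_{j=1}^{r} R_{j} \cap \boldsymbol{T}_{j},$$ where each $R_{j} \cap \boldsymbol{T}_{j}$ is a patterned polyhedron in $\mathbb{R}^{n_{1}}$ with period $\mathcal{T}_{j} \subseteq \mathbb{Z}^{n_{1}}$. The polyhedra $R_{j}$ and lattices $\mathcal{T}_{j}$ can be found in time polynomial in $\phi(F)$.
   Context: $\mathbb{Z}_{+} = \{1,2,\ldots\}$. All variables range over $\mathbb{Z}$. Presburger Arithmetic (PA) is the first order theory of the integers with only additions and inequalities: atoms are integer inequalities $a_1x_1+\cdots+a_nx_n \le b$ with integer constants $a_i, b$, and formulas are formed by Boolean combinations and quantifiers $\forall/\exists$. For $k \in \mathbb{Z}_{+}$ and a vector of dimensions $\overline{n} = (n_1,\ldots,n_k) \in \mathbb{Z}_{+}^{k}$, let $\mathbf{x}_i \in \mathbb{Z}^{n_i}$, $1 \le i \le k$, be vectors of integer variables. $\mathrm{PA}_{k,\overline{n}}$ is the class of formulas of the form $$F = \bigl\{ \mathbf{x}_{1} : Q_{2}\,\mathbf{x}_{2} \dots Q_{k}\,\mathbf{x}_{k} \; \Phi(\mathbf{x}_{1}, \dots, \mathbf{x}_{k}) \bigr\},$$ where $Q_2,\ldots,Q_k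 \in \{\forall,\exists\}$ are any quantifiers and $\Phi$ is a Boolean combination of integer linear inequalities in $\mathbf{x}_1,\ldots,\mathbf{x}_k$. A point $\mathbf{x}_1 \in \mathbb{Z}^{n_1}$ satisfies $F$ if the sentence $F(\mathbf{x}_1)$ obtained by substituting it is true; $F$ is identified with the set of $\mathbf{x}_1 \in \mathbb{Z}^{n_1}$ satisfying it. The length $\phi(F)$ is the total length of all symbols and constants in $F$ written in binary. Let $\mathcal{L} \subseteq \mathbb{Z}^{d}$ be a full-rank lattice. A pattern $\boldsymbol{L}$ with period $\mathcal{L}$ is a union of finitely many (integer) cosets of $\mathcal{L}$. For a rational polyhedron $R \subseteq \mathbb{R}^d$ and a pattern $\boldsymbol{L}$ with period $\mathcal{L}$, the set $R \cap \boldsymbol{L}$ is called a patterned polyhedron with period $\mathcal{L}$. Polyhedra are given by integer linear systems and lattices by generating matrices, in binary. The statement does not assert that the patterns $\boldsymbol{T}_j$ themselves are computed. *)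

(* Defs.v *)
From mathcomp Require Import all_boot all_order all_algebra.
From mathcomp Require Import all_classical reals.
Set Implicit Arguments.
Unset Strict Implicit.
Unset Printing Implicit Defensive.
Import Order.TTheory GRing.Theory Num.Theory.
Local Open Scope classical_set_scope.
Local Open Scope ring_scope.

(** * Polynomial time *)

(** Time is measured on multi-stack machines over the binary alphabet, with a
structured finite control.  One stack is half of a Turing machine tape (the
cells on one side of the head), so these programs and multitape Turing machines
simulate each other with a constant-factor overhead. *)
Inductive program :=
| Skip
| Push (v : nat) (b : bool)
| Pop (v : nat)
| Seq (p q : program)
| Switch (v : nat) (pempty pfalse ptrue : program)
| While (v : nat) (p : program).

Definition store := nat -> seq bool.

(** [exec p s t s']: started on the stacks [s], [p] halts after [t] elementary
steps with the stacks [s'].  The loop runs as long as its stack is nonempty. *)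
Inductive exec : program -> store -> nat -> store -> Prop :=
| ExecSkip s : exec Skip s 1 s
| ExecPush v b s : exec (Push v b) s 1 [eta s with v |-> b :: s v]
| ExecPop v s : exec (Pop v) s 1 [eta s with v |-> behead (s v)]
| ExecSeq p q s1 s2 s3 t u :
    exec p s1 t s2 -> exec q s2 u s3 -> exec (Seq p q) s1 (t + u) s3
| ExecSwitch v pempty pfalse ptrue s s' t :
    exec (if s v is b :: _ then if b then ptrue else pfalse else pempty) s t s' ->
    exec (Switch v pempty pfalse ptrue) s t.+1 s'
| ExecWhileDone v p s : s v = [::] -> exec (While v p) s 1 s
| ExecWhileLoop v p s1 s2 s3 t u :
    s1 v <> [::] -> exec p s1 t s2 -> exec (While v p) s2 u s3 ->
    exec (While v p) s1 (t + u).+1 s3.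

(** Input and output words are on stack 0; the other stacks start empty. *)
Definition outputs (p : program) (w : seq bool) (t : nat) (w' : seq bool) :=
  exists2 s : store, exec p [eta fun=> [::] with 0%N |-> w] t s & s 0%N = w'.

(** Given [x : I], some [y : O] with [spec x y] can be found in time polynomial
in [len x]. *)
Definition found_in_poly_time (I O : Type) (len : I -> nat)
    (encI : I -> seq bool) (encO : O -> seq bool) (spec : I -> O -> Prop) :=
  exists (p : program) (P : {poly nat}), forall x : I,
    exists (y : O) (t : nat),
      [/\ outputs p (encI x) t (encO y), (t <= P.[len x])%N & spec x y].

(** * Binary encodings *)

(** All the encodings below are prefix-free, hence concatenations of codes can
be decoded. *)
Definition enc_seq (T : Type) (enc : T -> seq bool) (s : seq T) : seq bool :=
  flatten [seq true :: enc x | x <- s] ++ [:: false].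

(** Binary digits, least significant first; [up_log 2 m.+1] is the number of
digits of [m], so that [0] has the empty expansion. *)
Definition binary_digits (m : nat) : seq bool :=
  [seq odd (m %/ 2 ^ i) | i <- iota 0 (up_log 2 m.+1)].

Definition enc_nat (m : nat) : seq bool :=
  enc_seq (fun b => [:: b]) (binary_digits m).

Definition enc_int (z : int) : seq bool := (z < 0) :: enc_nat `|z|%N.

(** The dimensions are not encoded: they are fixed wherever this is used. *)
Definition enc_mx (m n : nat) (A : 'M[int]_(m, n)) : seq bool :=
  flatten [seq enc_int (A i j) | i <- enum 'I_m, j <- enum 'I_n].

(** * Presburger formulas *)

Section Presburger.

(** There are [k.+1] blocks of variables; block [i] is a vector of [n i]
variables.  Block [ord0] is free and block [lift ord0 i] is bound by the [i]-th
quantifier, the one for [i = 0] being outermost. *)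
Variables (k : nat) (n : 'I_k.+1 -> nat).

Inductive qf_formula :=
| Leq (a : forall i, 'rV[int]_(n i)) (b : int)
| Not (f : qf_formula)
| And (f g : qf_formula)
| Or (f g : qf_formula).

Inductive quantifier := Forall | Exists.

Record PA := MkPA { quant : 'I_k -> quantifier; matrix_of : qf_formula }.

Definition valuation := forall i, 'cV[int]_(n i).

Fixpoint qf_holds (f : qf_formula) (x : valuation) : Prop :=
  match f with
  | Leq a b => \sum_i (a i *m x i) 0 0 <= b
  | Not f => ~ qf_holds f x
  | And f g => qf_holds f x /\ qf_holds g x
  | Or f g => qf_holds f x \/ qf_holds g x
  end.

Definition quantify (q : quantifier) (T : Type) (P : T -> Prop) : Prop :=
  match q with
  | Forall => forall y, P y
  | Exists => exists y, P y
  end.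

Definition PA_holds (F : PA) : valuation -> Prop :=
  foldr (fun (i : 'I_k) (P : valuation -> Prop) (x : valuation) =>
           quantify (quant F i)
             (fun y : 'cV[int]_(n (lift ord0 i)) => P (dfwith x (lift ord0 i) y)))
        (qf_holds (matrix_of F)) (enum 'I_k).

(** The values given to the bound blocks are irrelevant: each of them is
overwritten by its quantifier. *)
Definition PA_set (F : PA) : set 'cV[int]_(n ord0) :=
  [set x1 | PA_holds F (dfwith (fun i => 0 : 'cV[int]_(n i)) ord0 x1)].

Fixpoint enc_qf (f : qf_formula) : seq bool :=
  match f with
  | Leq a b =>
      [:: false; false] ++ flatten [seq enc_mx (a i) | i <- enum 'I_k.+1]
        ++ enc_int b
  | Not f => [:: false; true] ++ enc_qf f
  | And f g => [:: true; false] ++ enc_qf f ++ enc_qf g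
  | Or f g => [:: true; true] ++ enc_qf f ++ enc_qf g
  end.

Definition enc_PA (F : PA) : seq bool :=
  [seq (if quant F i is Forall then true else false) | i <- enum 'I_k]
    ++ enc_qf (matrix_of F).

(** The length phi(F): every symbol takes boundedly many bits, and every
constant is written in binary. *)
Definition PA_length (F : PA) : nat := size (enc_PA F).

End Presburger.

(** * Patterned polyhedra *)

(** An integer linear system: the list of its inequalities [c.1 *m x <= c.2]. *)
Definition linear_system (d : nat) := seq ('rV[int]_d * int).

Definition polyhedron (R : realType) (d : nat) (S : linear_system d) :
    set 'cV[R]_d :=
  [set x | forall c, c \in S -> (map_mx intr c.1 *m x) 0 0 <= c.2%:~R].

(** The lattice generated by the columns of [G]; it has full rank if and only
if [\det G != 0]. *)
Definition lattice (d : nat) (G : 'M[int]_d) : set 'cV[int]_d :=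
  range (fun z : 'cV[int]_d => G *m z).

Definition pattern (d : nat) (G : 'M[int]_d) (T : set 'cV[int]_d) : Prop :=
  exists cs : seq 'cV[int]_d,
    T = \bigcup_(c in [set` cs]) [set c + v | v in lattice G].

(** The points of a patterned polyhedron are integral, so it is given as a
subset of Z^d. *)
Definition patterned_polyhedron (R : realType) (d : nat) (S : linear_system d)
    (T : set 'cV[int]_d) : set 'cV[int]_d :=
  [set x | polyhedron S (map_mx intr x : 'cV[R]_d)] `&` T.

(** [X] is the disjoint union of patterned polyhedra with the polyhedra and the
periods listed in [D], for some choice of the patterns. *)
Definition patterned_decomposition (R : realType) (d : nat)
    (X : set 'cV[int]_d) (D : seq (linear_system d * 'M[int]_d)) : Prop :=
  let S j := (tnth (in_tuple D) j).1 in
  let G j := (tnth (in_tuple D) j).2 in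
  (forall j, \det (G j) != 0) /\
  exists T : 'I_(size D) -> set 'cV[int]_d,
    [/\ forall j, pattern (G j) (T j),
        trivIset setT (fun j => patterned_polyhedron R (S j) (T j)) &
        X = \bigcup_j patterned_polyhedron R (S j) (T j)].

Definition enc_inequality (d : nat) (c : 'rV[int]_d * int) : seq bool :=
  enc_mx c.1 ++ enc_int c.2.

Definition enc_decomposition (d : nat)
    (D : seq (linear_system d * 'M[int]_d)) : seq bool :=
  enc_seq (fun SG => enc_seq (@enc_inequality d) SG.1 ++ enc_mx SG.2) D.

(* Main.v *)
Require Import Defs.
From mathcomp Require Import all_boot all_order all_algebra.
From mathcomp Require Import all_classical reals.
From mathcomp Require Import zify ring.
Set Implicit Arguments.
Unset Strict Implicit.
Unset Printing Implicit Defensive.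
Import Order.TTheory GRing.Theory Num.Theory.
Local Open Scope nat_scope.

(** Since the patterns need not be computed, no parametric integer programming is
    needed: quantifiers are eliminated semantically.  Call two points equivalent for a
    modulus [M] and a list [H] of integer affine forms if they are congruent modulo [M]
    and every [h <= 0], [h] in [H], holds at both or at neither.  The truth of the matrix
    of a formula is invariant under such an equivalence.  One variable [y] is eliminated as
    follows: let [p_i] be the zero in [y] of the [i]-th form; [y] may be translated by a
    multiple of [M], without changing a sign, to distance at most [M] of some [p_i].
    Hence it suffices to keep the forms evaluated at all [p_i + M] and [p_i - M], cleared of
    denominators, and to enlarge the modulus so that, when some [p_j - p_i] has absolute
    value at most [M], congruence fixes it: then any [y] for one point is answered by some
    [y'] for an equivalent point, as in a back-and-forth game, and the truth of both the
    existential and the universal formula is preserved.  The number of variables being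
    fixed, iterating this leaves polynomially many forms and one modulus, with polynomially
    many digits.  On each cell of the arrangement of these forms the formula is periodic.

    The sign vectors of the cells are enumerated by virtual substitution: the signs of all
    forms at [(x, y)] are those at the last zero before [y], or just after it, or at -oo,
    and these are signs of forms in [x].  The enumeration may contain empty or repeated
    cells, which is harmless because their patterns may be chosen empty.

    Polynomial time is proved for functions on words, pairs and lists, closed under
    composition and under folds whose states have polynomially bounded size. *)

(** * Runs with a time bound, on windows of stacks *)

Definition run (p : program) (s : store) (n : nat) (s' : store) :=
  exists2 t, t <= n & exec p s t s'.

Definition upd (s : store) (v : nat) (w : seq bool) : store :=
  fun i => if i == v then w else s i.

(* The stacks from [k] on hold the words [ws], and are empty after them. *)
Definition st (k : nat) (s : store) (ws : seq (seq bool)) : store :=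
  fun i => if i < k then s i else nth [::] ws (i - k).

Lemma st_at k s ws j : st k s ws (k + j) = nth [::] ws j.
Proof. by rewrite /st ltnNge leq_addr addKn. Qed.

Lemma upd_st k s ws j w : upd (st k s ws) (k + j) w = st k s (set_nth [::] ws j w).
Proof.
apply: funext => i; rewrite /upd /st; case: ltnP => ki.
  by case: eqP => // ij; lia.
rewrite nth_set_nth /=; have -> // : (i == k + j) = (i - k == j).
by apply/eqP/eqP; lia.
Qed.

(** Words saved on the lower stacks become part of the surrounding store, so a program specified on
    a window that starts higher can run above them. *)
Lemma st_cat k s ws us : st (k + size ws) (st k s ws) us = st k s (ws ++ us).
Proof.
apply: funext => i; rewrite /st nth_cat.
have [ki|ki] := ltnP i k; first by rewrite ltn_addr.
have -> : (i < k + size ws) = (i - k < size ws) by lia.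
by rewrite subnDA.
Qed.

Lemma st_ext k s ws us :
  (forall j, nth [::] ws j = nth [::] us j) -> st k s ws = st k s us.
Proof. by move=> e; apply: funext => i; rewrite /st e. Qed.

Lemma run_leq p s m n s' : run p s m s' -> m <= n -> run p s n s'.
Proof. by case=> t tm e mn; exists t => //; apply: leq_trans mn. Qed.

Lemma run_seq p q s1 m s2 n s3 :
  run p s1 m s2 -> run q s2 n s3 -> run (Seq p q) s1 (m + n) s3.
Proof.
case=> t tm e [u un f]; exists (t + u); first exact: leq_add.
exact: ExecSeq e f.
Qed.

Lemma run_skip s : run Skip s 1 s.
Proof. by exists 1 => //; apply: ExecSkip. Qed.

Lemma run_push v b s : run (Push v b) s 1 (upd s v (b :: s v)).
Proof. by exists 1 => //; apply: ExecPush. Qed.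

Lemma run_pop v s : run (Pop v) s 1 (upd s v (behead (s v))).
Proof. by exists 1 => //; apply: ExecPop. Qed.

Lemma run_switch v p0 pf pt s n s' :
  run (if s v is b :: _ then if b then pt else pf else p0) s n s' ->
  run (Switch v p0 pf pt) s n.+1 s'.
Proof. by case=> t tn e; exists t.+1 => //; apply: ExecSwitch. Qed.

Lemma run_while_done v p s : s v = [::] -> run (While v p) s 1 s.
Proof. by move=> e; exists 1 => //; apply: ExecWhileDone. Qed.

Lemma run_while v p s1 m s2 n s3 :
  s1 v <> [::] -> run p s1 m s2 -> run (While v p) s2 n s3 ->
  run (While v p) s1 (m + n).+1 s3.
Proof.
move=> e [t tm f] [u un g]; exists (t + u).+1; first by rewrite ltnS leq_add.
exact: ExecWhileLoop e f g.
Qed.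

(** A step pushes at most one bit; hence running times will bound output lengths. *)
Lemma exec_size p s t s' v : exec p s t s' -> size (s' v) <= size (s v) + t.
Proof.
move=> e; elim: {p s t s'} e v
  => [s|w b s|w s|p q s1 s2 s3 t u _ h1 _ h2|w p0 pf pt s s' t _ h|w p s _
     |w p s1 s2 s3 t u _ _ h1 _ h2] v /=; rewrite ?leq_addr //.
- by case: ifP => [/eqP ->|_] /=; lia.
- by case: ifP => [/eqP ->|_] /=; rewrite ?size_behead; lia.
- by move: (h1 v) (h2 v); lia.
- by move: (h v); lia.
- by move: (h1 v) (h2 v); lia.
Qed.

Lemma run_size p s n s' v : run p s n s' -> size (s' v) <= size (s v) + n.
Proof. by case=> t tn /(exec_size v) e; apply: leq_trans e _; rewrite leq_add2l. Qed.

(** * Moving words between stacks *)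

Definition drain (v : nat) (B : bool -> program) : program :=
  While v (Switch v Skip (Seq (Pop v) (B false)) (Seq (Pop v) (B true))).

(** Loop invariant: [sigma u w] is the store when [w] is still on [v] and the bits of [u], latest
    first, have been read. Besides the [c] steps of [B], a round costs one step each for the loop,
    the switch and the pop. *)
Lemma run_drain (v : nat) (B : bool -> program) (c : nat)
    (sigma : seq bool -> seq bool -> store) :
    (forall u b w, run (B b) (upd (sigma u (b :: w)) v w) c (sigma (b :: u) w)) ->
    (forall u w, sigma u w v = w) ->
  forall w u, run (drain v B) (sigma u w) (c.+3 * size w + 1) (sigma (catrev w u) [::]).
Proof.
move=> runB sigmav; elim=> [|b w IHw] u.
  by rewrite muln0; apply: run_while_done; rewrite sigmav.
apply: (@run_leq _ _ ((1 + c).+1 + (c.+3 * size w + 1)).+1); last by rewrite /=; lia.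
apply: (run_while _ _ (IHw (b :: u))); first by rewrite sigmav.
apply: run_switch; rewrite sigmav.
have popb : run (Pop v) (sigma u (b :: w)) 1 (upd (sigma u (b :: w)) v w).
  by have := run_pop v (sigma u (b :: w)); rewrite sigmav.
by case: b popb => popb; apply: (run_seq popb (runB _ _ _)).
Qed.

Lemma run_eq p s n s1 s2 : run p s n s1 -> s1 = s2 -> run p s n s2.
Proof. by move=> ? <-. Qed.

Ltac split_upd :=
  rewrite /upd /=;
  repeat (match goal with |- context [?x == ?y] => case: (eqVneq x y) => ?; subst end);
  rewrite /= ?eqxx //.

Ltac store_eq :=
  try (let i := fresh "i" in apply: funext => i); split_upd; try congruence; try lia.

Lemma upd_eq s a w : upd s a w a = w.
Proof. by store_eq. Qed.

Definition move (a b : nat) : program := drain a (Push b).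

Lemma run_move a b s : a != b ->
  run (move a b) s (4 * size (s a) + 1) (upd (upd s a [::]) b (rev (s a) ++ s b)).
Proof.
move=> ab.
have := @run_drain a (Push b) 1 (fun u w => upd (upd s a w) b (u ++ s b)).
move/(_ _ _ (s a) [::]) => h.
have e : s = upd (upd s a (s a)) b ([::] ++ s b) by store_eq.
rewrite {1}e; apply: run_eq (h _ _) _; last by rewrite catrevE cats0; store_eq.
- by move=> u x w; apply: run_eq (run_push _ _ _) _; store_eq.
- by move=> u w; store_eq.
Qed.

Definition move2 (a b c : nat) : program := drain a (fun x => Seq (Push b x) (Push c x)).

Lemma run_move2 a b c s : a != b -> a != c -> b != c ->
  run (move2 a b c) s (5 * size (s a) + 1)
    (upd (upd (upd s a [::]) b (rev (s a) ++ s b)) c (rev (s a) ++ s c)).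
Proof.
move=> ab ac bc.
have := @run_drain a (fun x => Seq (Push b x) (Push c x)) 2
  (fun u w => upd (upd (upd s a w) b (u ++ s b)) c (u ++ s c)).
move/(_ _ _ (s a) [::]) => h.
have e : s = upd (upd (upd s a (s a)) b ([::] ++ s b)) c ([::] ++ s c) by store_eq.
rewrite {1}e; apply: run_eq (h _ _) _; last by rewrite catrevE cats0.
- move=> u x w; apply: run_eq (run_seq (run_push _ _ _) (run_push _ _ _)) _.
  by store_eq.
- by move=> u w; store_eq.
Qed.

Definition dbits (u : seq bool) : seq bool := flatten [seq [:: true; b] | b <- u].

(** A self-delimiting form: [true] announces each bit and [false] closes the word, so another word
    may follow on the same stack. *)
Definition dbl (u : seq bool) : seq bool := dbits u ++ [:: false].

Definition move_dbl (a b : nat) : program :=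
  drain a (fun x => Seq (Push b x) (Push b true)).

Lemma run_move_dbl a b s : a != b ->
  run (move_dbl a b) s (5 * size (s a) + 1)
    (upd (upd s a [::]) b (dbits (rev (s a)) ++ s b)).
Proof.
move=> ab.
have := @run_drain a (fun x => Seq (Push b x) (Push b true)) 2
  (fun u w => upd (upd s a w) b (dbits u ++ s b)).
move/(_ _ _ (s a) [::]) => h.
have e : s = upd (upd s a (s a)) b (dbits [::] ++ s b) by store_eq.
rewrite {1}e; apply: run_eq (h _ _) _; last by rewrite catrevE cats0.
- move=> u x w; apply: run_eq (run_seq (run_push _ _ _) (run_push _ _ _)) _.
  by store_eq.
- by move=> u w; store_eq.
Qed.

Definition clear (a : nat) : program := While a (Pop a).

Lemma run_clear a s : run (clear a) s (2 * size (s a) + 1) (upd s a [::]).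
Proof.
move e: (s a) => w; elim: w s e => [|b w IHw] s e.
  by apply: run_eq (run_while_done _ e) _; store_eq.
have -> : 2 * size (b :: w) + 1 = (1 + (2 * size w + 1)).+1 by rewrite /=; lia.
have -> : upd s a [::] = upd (upd s a w) a [::] by store_eq.
apply: run_while; last by apply: IHw; store_eq.
- by rewrite e.
- by apply: run_eq (run_pop _ _) _; rewrite e.
Qed.

(* Loops reading a self-delimiting word cannot run until their stack is empty,
   hence the flag on stack [c]. *)
Definition uncons (a b c : nat) : program :=
  Seq (Push c true)
    (While c (Switch a (Pop c) (Seq (Pop a) (Pop c))
       (Seq (Pop a) (Switch a Skip (Seq (Pop a) (Push b false)) (Seq (Pop a) (Push b true)))))).

Lemma run_uncons a b c s u v : a != b -> a != c -> b != c ->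
    s c = [::] -> s a = dbl u ++ v ->
  run (uncons a b c) s (6 * size u + 6) (upd (upd s a v) b (rev u ++ s b)).
Proof.
move=> ab ac bc sc sa.
have -> : 6 * size u + 6 = 1 + (6 * size u + 5) by lia.
apply: run_seq (run_push _ _ _) _; rewrite sc.
elim: u s sc sa => [|x u IHu] s sc sa.
  have -> : 6 * size (Nil bool) + 5 = ((1 + 1).+1 + 1).+1 by [].
  apply: run_while; last by apply: run_while_done; store_eq.
  - by store_eq.
  - apply: run_switch; rewrite (_ : upd s c _ a = s a) ?sa /=; last by store_eq.
    by apply: run_eq (@run_seq _ _ _ 1 _ 1 _ (run_pop _ _) (run_pop _ _)) _; store_eq; rewrite sa.
have -> : 6 * size (x :: u) + 5 = ((1 + (1 + 1).+1).+1 + (6 * size u + 5)).+1 by rewrite /=; lia.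
have -> : upd (upd s a v) b (rev (x :: u) ++ s b) =
    upd (upd (upd (upd s a (dbl u ++ v)) b (x :: s b)) a v) b
      (rev u ++ upd (upd s a (dbl u ++ v)) b (x :: s b) b).
  by store_eq; rewrite rev_cons cat_rcons.
apply: run_while; last by apply: IHu; store_eq.
- by store_eq.
- apply: run_switch; rewrite (_ : upd s c _ a = s a) ?sa /=; last by store_eq.
  apply: (@run_seq _ _ _ 1 _ 3 _ (run_pop _ _)); apply: run_switch.
  rewrite upd_eq (_ : behead _ = x :: dbl u ++ v); last by store_eq; rewrite sa.
  case: x {IHu} sa => sa; apply: run_eq (@run_seq _ _ _ 1 _ 1 _ (run_pop _ _) (run_push _ _ _)) _;
    store_eq; by rewrite ?sa.
Qed.

(** The empty list is coded by the empty word, and the same program has to halt on it; this will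
    give [behead [::] = [::]]. *)
Lemma run_uncons_nil a b c s : a != b -> a != c -> b != c ->
    s c = [::] -> s a = [::] ->
  run (uncons a b c) s 6 s.
Proof.
move=> ab ac bc sc sa.
apply: (@run_seq _ _ _ 1 (upd s c [:: true]) 5).
  by apply: run_eq (run_push _ _ _) _; rewrite sc.
apply: (@run_leq _ _ (2 + 1).+1) => //.
apply: (@run_while _ _ _ _ s); last exact: run_while_done.
- by store_eq.
- apply: run_switch; rewrite (_ : upd s c _ a = s a) ?sa /=; last by store_eq.
  by apply: run_eq (run_pop _ _) _; store_eq.
Qed.

Lemma st_move k s ws i j : i != j ->
  run (move (k + i) (k + j)) (st k s ws) (4 * size (nth [::] ws i) + 1)
    (st k s (set_nth [::] (set_nth [::] ws i [::]) j (rev (nth [::] ws i) ++ nth [::] ws j))).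
Proof.
move=> ij; apply: run_eq (run_leq (run_move _ _) _) _; rewrite ?eqn_add2l ?st_at //.
by rewrite !upd_st.
Qed.

Lemma st_move2 k s ws i j l : i != j -> i != l -> j != l ->
  run (move2 (k + i) (k + j) (k + l)) (st k s ws) (5 * size (nth [::] ws i) + 1)
    (st k s (set_nth [::] (set_nth [::] (set_nth [::] ws i [::])
       j (rev (nth [::] ws i) ++ nth [::] ws j)) l (rev (nth [::] ws i) ++ nth [::] ws l))).
Proof.
move=> ij il jl; apply: run_eq (run_leq (run_move2 _ _ _ _) _) _; rewrite ?eqn_add2l ?st_at //.
by rewrite !upd_st.
Qed.

Lemma st_move_dbl k s ws i j : i != j ->
  run (move_dbl (k + i) (k + j)) (st k s ws) (5 * size (nth [::] ws i) + 1)
    (st k s (set_nth [::] (set_nth [::] ws i [::]) j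
       (dbits (rev (nth [::] ws i)) ++ nth [::] ws j))).
Proof.
move=> ij; apply: run_eq (run_leq (run_move_dbl _ _) _) _; rewrite ?eqn_add2l ?st_at //.
by rewrite !upd_st.
Qed.

Lemma st_clear k s ws i :
  run (clear (k + i)) (st k s ws) (2 * size (nth [::] ws i) + 1) (st k s (set_nth [::] ws i [::])).
Proof. by apply: run_eq (run_leq (run_clear _ _) _) _; rewrite ?st_at ?upd_st. Qed.

Lemma st_push k s ws i b :
  run (Push (k + i) b) (st k s ws) 1 (st k s (set_nth [::] ws i (b :: nth [::] ws i))).
Proof. by apply: run_eq (run_push _ _ _) _; rewrite ?st_at ?upd_st. Qed.

Lemma st_pop k s ws i :
  run (Pop (k + i)) (st k s ws) 1 (st k s (set_nth [::] ws i (behead (nth [::] ws i)))).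
Proof. by apply: run_eq (run_pop _ _) _; rewrite ?st_at ?upd_st. Qed.

Lemma st_uncons k s ws i j l u v : i != j -> i != l -> j != l ->
    nth [::] ws l = [::] -> nth [::] ws i = dbl u ++ v ->
  run (uncons (k + i) (k + j) (k + l)) (st k s ws) (6 * size u + 6)
    (st k s (set_nth [::] (set_nth [::] ws i v) j (rev u ++ nth [::] ws j))).
Proof.
move=> ij il jl wl wi; apply: run_eq (@run_uncons _ _ _ _ u v _ _ _ _ _) _;
  rewrite ?eqn_add2l ?st_at //.
by rewrite !upd_st.
Qed.

Lemma st_uncons_nil k s ws i j l : i != j -> i != l -> j != l ->
    nth [::] ws l = [::] -> nth [::] ws i = [::] ->
  run (uncons (k + i) (k + j) (k + l)) (st k s ws) 6 (st k s ws).
Proof. by move=> ij il jl wl wi; apply: run_uncons_nil; rewrite ?eqn_add2l ?st_at. Qed.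

Lemma size_dbits u : size (dbits u) = 2 * size u.
Proof. by rewrite /dbits; elim: u => //= b u ->; lia. Qed.

Lemma size_dbl u : size (dbl u) = 2 * size u + 1.
Proof. by rewrite size_cat size_dbits. Qed.

Ltac st_trim := apply: st_ext; do 6?[case=> //=]; move=> ?; rewrite ?nth_nil.

Ltac run_start := eapply run_eq; [eapply run_leq|].

Ltac run_step h := eapply run_seq; [exact h|]; rewrite /= ?cats0 ?revK.

(** * Programs for pairs, tests and loops over lists *)

Definition fst_prog (k : nat) : program :=
  Seq (uncons (k + 0) (k + 1) (k + 2)) (Seq (clear (k + 0)) (move (k + 1) (k + 0))).

Lemma run_fst k s u v :
  run (fst_prog k) (st k s [:: dbl u ++ v]) (10 * (size u + size v) + 8) (st k s [:: u]).
Proof.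
apply: run_eq (run_leq (run_seq (@st_uncons _ _ _ 0 1 2 u v _ _ _ _ _)
  (run_seq (st_clear _ _ _ 0) (@st_move _ _ _ 1 0 _))) _) _ => //=.
- by rewrite cats0 size_rev; lia.
- by rewrite !cats0 revK; st_trim.
Qed.

Definition snd_prog (k : nat) : program :=
  Seq (uncons (k + 0) (k + 1) (k + 2)) (clear (k + 1)).

Lemma run_snd k s u v :
  run (snd_prog k) (st k s [:: dbl u ++ v]) (10 * (size u + size v) + 7) (st k s [:: v]).
Proof.
apply: run_eq (run_leq (run_seq (@st_uncons _ _ _ 0 1 2 u v _ _ _ _ _)
  (st_clear _ _ _ 1)) _) _ => //=.
- by rewrite cats0 size_rev; lia.
- by st_trim.
Qed.

Lemma run_snd_nil k s : run (snd_prog k) (st k s [:: [::]]) 7 (st k s [:: [::]]).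
Proof.
apply: run_eq (run_leq (run_seq (@st_uncons_nil _ _ _ 0 1 2 _ _ _ _ _)
  (st_clear _ _ _ 1)) _) _ => //=.
by st_trim.
Qed.

Fixpoint pushes (k : nat) (u : seq bool) : program :=
  if u is b :: u then Seq (pushes k u) (Push k b) else Skip.

Definition const_prog (u : seq bool) (k : nat) : program :=
  Seq (clear (k + 0)) (pushes (k + 0) u).

Lemma run_const k s u w :
  run (const_prog u k) (st k s [:: w]) (2 * size w + size u + 2) (st k s [:: u]).
Proof.
suff h : run (pushes (k + 0) u) (st k s [:: [::]]) (size u + 1) (st k s [:: u]).
  by apply: run_leq (run_seq (st_clear k s [:: w] 0) h) _ => /=; lia.
elim: u => [|b u IHu] /=; first exact: run_skip.
by apply: run_leq (run_seq IHu (st_push _ _ _ 0 b)) _; lia.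
Qed.

(** The input is duplicated; [p] works on one copy in the window at [k + 2], then [q] on the other
    at [k + 3], so neither disturbs the words below. Moving a word reverses it, whence the double
    moves. *)
Definition pair_prog (p q : nat -> program) (k : nat) : program :=
  Seq (move (k + 0) (k + 1)) (Seq (move2 (k + 1) (k + 0) (k + 2)) (Seq (p (k + 2))
  (Seq (move (k + 0) (k + 1)) (Seq (move (k + 1) (k + 3)) (Seq (q (k + 3))
  (Seq (move (k + 3) (k + 4)) (Seq (move (k + 4) (k + 0)) (Seq (Push (k + 0) false)
  (Seq (move (k + 2) (k + 4)) (move_dbl (k + 4) (k + 0))))))))))).

Lemma run_pair p q k s w u v m n :
    (forall k s, run (p k) (st k s [:: w]) m (st k s [:: u])) ->
    (forall k s, run (q k) (st k s [:: w]) n (st k s [:: v])) ->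
  run (pair_prog p q k) (st k s [:: w])
    (m + n + 20 * (size w + size u + size v) + 20) (st k s [:: dbl u ++ v]).
Proof.
move=> hp hq.
have hp2 : run (p (k + 2)) (st k s [:: w; [::]; w]) m (st k s [:: w; [::]; u]).
  by have := hp (k + 2) (st k s [:: w; [::]]); rewrite !(@st_cat _ _ [:: w; [::]]).
have hq2 : run (q (k + 3)) (st k s [:: [::]; [::]; u; w]) n (st k s [:: [::]; [::]; u; v]).
  have := hq (k + 3) (st k s [:: [::]; [::]; u]).
  by rewrite !(@st_cat _ _ [:: [::]; [::]; u]).
run_start.
- run_step (@st_move k s [:: w] 0 1 isT).
  run_step (@st_move2 k s [:: [::]; rev w] 1 0 2 isT isT isT).
  run_step hp2.
  run_step (@st_move k s [:: w; [::]; u] 0 1 isT).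
  run_step (@st_move k s [:: [::]; rev w; u] 1 3 isT).
  run_step hq2.
  run_step (@st_move k s [:: [::]; [::]; u; v] 3 4 isT).
  run_step (@st_move k s [:: [::]; [::]; u; [::]; rev v] 4 0 isT).
  run_step (@st_push k s [:: v; [::]; u; [::]; [::]] 0 false).
  run_step (@st_move k s [:: false :: v; [::]; u; [::]; [::]] 2 4 isT).
  exact: (@st_move_dbl k s [:: false :: v; [::]; [::]; [::]; rev u] 4 0 isT).
- by rewrite /= ?cats0 !size_rev; lia.
- by rewrite /= revK /dbl -catA; st_trim.
Qed.

(** Pairing the test bit [x] with the input [w] yields [true :: x :: false :: w]: the marker is
    popped, [x] is inspected, and [x] and [false] are popped before a branch runs on [w]. *)
Definition if_prog (b p q : nat -> program) (k : nat) : program :=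
  Seq (pair_prog b (fun k => Skip) k)
    (Seq (Pop (k + 0)) (Switch (k + 0) Skip
      (Seq (Pop (k + 0)) (Seq (Pop (k + 0)) (q k)))
      (Seq (Pop (k + 0)) (Seq (Pop (k + 0)) (p k))))).

Lemma run_if b p q k s w (x : bool) u l m n :
    (forall k s, run (b k) (st k s [:: w]) l (st k s [:: [:: x]])) ->
    (x -> run (p k) (st k s [:: w]) m (st k s [:: u])) ->
    (~~ x -> run (q k) (st k s [:: w]) n (st k s [:: u])) ->
  run (if_prog b p q k) (st k s [:: w]) (l + m + n + 40 * size w + 50) (st k s [:: u]).
Proof.
move=> hb hp hq; run_start.
- run_step (@run_pair b (fun=> Skip) k s w [:: x] w l 1 hb (fun _ _ => run_skip _)).
  run_step (@st_pop k s [:: true :: x :: false :: w] 0).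
  apply: run_switch; rewrite st_at /=.
  apply: (@run_leq _ _ (1 + (1 + (m + n)))); last exact: leqnn.
  case: x hp hq {hb} => [/(_ isT) hp _|_ /(_ isT) hq].
    run_step (@st_pop k s [:: true :: false :: w] 0).
    run_step (@st_pop k s [:: false :: w] 0).
    by apply: run_leq hp _; rewrite leq_addr.
  run_step (@st_pop k s [:: false :: false :: w] 0).
  run_step (@st_pop k s [:: false :: w] 0).
  by apply: run_leq hq _; rewrite leq_addl.
- by rewrite /=; lia.
- by [].
Qed.

Definition nilp_prog (k : nat) : program :=
  Switch (k + 0) (Push (k + 0) true) (const_prog [:: false] k) (const_prog [:: false] k).

Lemma run_nilp k s w : run (nilp_prog k) (st k s [:: w]) (2 * size w + 4) (st k s [:: [:: nilp w]]).
Proof.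
apply: (@run_leq _ _ (2 * size w + 3).+1); last by lia.
apply: run_switch; rewrite st_at; case: w => [|b w] /=.
  by apply: run_leq (@st_push k s [:: [::]] 0 true) _; lia.
have h := run_const k s [:: false] (b :: w).
by case: b h => h; apply: run_leq h _ => /=; lia.
Qed.

Definition head_prog (d : seq bool) (k : nat) : program :=
  Switch (k + 0) (const_prog d k) (fst_prog k) (fst_prog k).

Lemma run_head_nil k s d : run (head_prog d k) (st k s [:: [::]]) (size d + 3) (st k s [:: d]).
Proof.
rewrite addnS; apply: run_switch; rewrite st_at /=.
exact: (run_const k s d [::]).
Qed.

Lemma run_head_cons k s d u v :
  run (head_prog d k) (st k s [:: dbl u ++ v]) (10 * (size u + size v) + 9) (st k s [:: u]).
Proof.
have h := run_fst k s u v; rewrite addnS; apply: run_switch; rewrite st_at /=.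
have: size (dbl u) != 0 by rewrite size_dbl addn1.
by case: (dbl u) h => [|[] ?].
Qed.

Definition enc_list (us : seq (seq bool)) : seq bool := flatten [seq dbl u | u <- us].

(* Stack [k] holds a list and stack [k.+1] the current state; [p] maps the pair of
   an item and a state to the new state. *)
Definition loop_prog (p : nat -> program) (k : nat) : program :=
  While (k + 0) (Seq (uncons (k + 0) (k + 2) (k + 3)) (Seq (Push (k + 1) false)
    (Seq (move_dbl (k + 2) (k + 1)) (p (k + 1))))).

(** The cost of [p] is bounded only at states reached from prefixes of [xs]; no single [m] could be
    expected to work for arbitrary states. *)
Lemma run_loop (T S : Type) (encT : T -> seq bool) (encS : S -> seq bool)
    p k s xs (f : S -> T -> S) w m :
    (forall l x r, xs = l ++ x :: r -> forall k s,
      run (p k) (st k s [:: dbl (encT x) ++ encS (foldl f w l)]) m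
                (st k s [:: encS (f (foldl f w l) x)])) ->
  run (loop_prog p k) (st k s [:: enc_list (map encT xs); encS w])
    ((m + 20) * size xs + 20 * size (enc_list (map encT xs)) + 1)
    (st k s [:: [::]; encS (foldl f w xs)]).
Proof.
elim: xs w => [|x xs IHxs] w hp.
  by apply: run_leq (@run_while_done _ _ _ _) _; rewrite ?st_at //; lia.
have hp1 : run (p (k + 1)) (st k s [:: enc_list (map encT xs); dbl (encT x) ++ encS w]) m
               (st k s [:: enc_list (map encT xs); encS (f w x)]).
  have := hp [::] x xs erefl (k + 1) (st k s [:: enc_list (map encT xs)]).
  by rewrite !(@st_cat _ _ [:: _]).
set u := encT x in hp1 *.
apply: (@run_leq _ _ ((6 * size u + 6 + (1 + ((5 * size u + 1) + m))) +
    ((m + 20) * size xs + 20 * size (enc_list (map encT xs)) + 1)).+1); last first.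
  by rewrite /enc_list /= size_cat size_dbl -/u; lia.
apply: run_while.
- by rewrite st_at /enc_list /=; case: (encT x).
- rewrite /enc_list /= -/(enc_list (map encT xs)) -/u.
  run_step (@st_uncons k s [:: dbl u ++ enc_list (map encT xs); encS w] 0 2 3
    u _ isT isT isT erefl erefl).
  run_step (@st_push k s [:: enc_list (map encT xs); encS w; rev u] 1 false).
  have h := @st_move_dbl k s [:: enc_list (map encT xs); false :: encS w; rev u] 2 1 isT.
  rewrite /= size_rev in h; run_step h.
  rewrite (_ : st k s _ = st k s [:: enc_list (map encT xs); dbl u ++ encS w]); first exact: hp1.
  by rewrite ?revK /dbl -catA; st_trim.
- apply: IHxs => l x' r e; exact: (hp (x :: l) x' r (congr1 (cons x) e)).
Qed.

Definition fold_prog (p q : nat -> program) (k : nat) : program :=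
  Seq (p k) (Seq (uncons (k + 0) (k + 1) (k + 2)) (Seq (move (k + 0) (k + 2))
  (Seq (move (k + 1) (k + 0)) (Seq (move (k + 2) (k + 1)) (Seq (loop_prog q k)
  (Seq (move (k + 1) (k + 2)) (move (k + 2) (k + 0)))))))).

Lemma run_fold (T S : Type) (encT : T -> seq bool) (encS : S -> seq bool)
    p q k s v xs (f : S -> T -> S) w l m :
    run (p k) (st k s [:: v]) l (st k s [:: dbl (enc_list (map encT xs)) ++ encS w]) ->
    (forall l x r, xs = l ++ x :: r -> forall k s,
      run (q k) (st k s [:: dbl (encT x) ++ encS (foldl f w l)]) m
                (st k s [:: encS (f (foldl f w l) x)])) ->
  run (fold_prog p q k) (st k s [:: v])
    (l + (m + 20) * size xs +
     40 * (size (enc_list (map encT xs)) + size (encS w) + size (encS (foldl f w xs))) + 20)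
    (st k s [:: encS (foldl f w xs)]).
Proof.
set us := map encT xs; move=> hp hq; run_start.
- run_step hp.
  run_step (@st_uncons k s [:: dbl (enc_list us) ++ encS w] 0 1 2 _ _ isT isT isT erefl erefl).
  run_step (@st_move k s [:: encS w; rev (enc_list us)] 0 2 isT).
  run_step (@st_move k s [:: [::]; rev (enc_list us); rev (encS w)] 1 0 isT).
  run_step (@st_move k s [:: enc_list us; [::]; rev (encS w)] 2 1 isT).
  have h := run_loop k s hq; rewrite -/us in h.
  rewrite (_ : st k s [:: enc_list us; encS w] = st k s [:: enc_list us; encS w; [::]]) in h;
    last by st_trim.
  run_step h.
  run_step (@st_move k s [:: [::]; encS (foldl f w xs)] 1 2 isT).
  exact: (@st_move k s [:: [::]; [::]; rev (encS (foldl f w xs))] 2 0 isT).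
- by rewrite /= !size_rev; lia.
- by rewrite /= ?revK ?cats0; st_trim.
Qed.

(** * Functions computable in polynomial time *)

Class code (T : Type) := encode : T -> seq bool.

Definition esize (T : Type) {cT : code T} (x : T) : nat := size (encode x).

Instance code_bool : code bool := fun b => [:: b].

Instance code_prod (A B : Type) {cA : code A} {cB : code B} : code (A * B) :=
  fun x => dbl (encode x.1) ++ encode x.2.

Instance code_seq (A : Type) {cA : code A} : code (seq A) :=
  fun s => enc_list [seq encode x | x <- s].

(** A digit occupies three symbols, being an item of a list of bits; in exchange, list programs act
    directly on numbers. *)
Instance code_nat : code nat := fun n => encode (binary_digits n).

Instance code_int : code int := fun z => encode ((z < 0)%R, `|z|).

(** The base is at least 2, so the powers grow with [c] and absorb constants, sums and products. *)
Definition pbounded (A : Type) {cA : code A} (g : A -> nat) : Prop :=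
  exists c, forall a, g a <= (esize a).+2 ^ c.

(* [p k] only uses the stacks from [k] on, which makes room for saved words below. *)
Definition ptime (A B : Type) {cA : code A} {cB : code B} (f : A -> B) : Prop :=
  exists (p : nat -> program) (T : A -> nat), pbounded T /\
    forall a k s, run (p k) (st k s [:: encode a]) (T a) (st k s [:: encode (f a)]).

Section PolynomialBounds.
Context {A B : Type} {cA : code A} {cB : code B}.
Implicit Types (g h : A -> nat) (f : A -> B).

Lemma pbounded_leq g h : (forall a, g a <= h a) -> pbounded h -> pbounded g.
Proof. by move=> gh [c hc]; exists c => a; apply: leq_trans (gh a) (hc a). Qed.

Lemma pbounded_const c : pbounded (fun _ : A => c).
Proof.
exists c => a; apply: leq_trans (ltnW (ltn_expl c (isT : 1 < 2))) _.
by case: c => // c; rewrite leq_exp2r.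
Qed.

Lemma pbounded_esize : pbounded (@esize A cA).
Proof. by exists 1 => a; rewrite expn1; lia. Qed.

Lemma pbounded_add g h : pbounded g -> pbounded h -> pbounded (fun a => g a + h a).
Proof.
move=> [c gc] [d hd]; exists (c + d).+1 => a.
have := gc a; have := hd a; set n := (esize a).+2 => hn gn.
have n0 : 0 < n by [].
have := leq_pexp2l n0 (leq_addr d c); have := leq_pexp2l n0 (leq_addl c d).
rewrite expnS; have : 2 * n ^ (c + d) <= n * n ^ (c + d) by rewrite leq_mul2r orbT.
lia.
Qed.

Lemma pbounded_mul g h : pbounded g -> pbounded h -> pbounded (fun a => g a * h a).
Proof. by move=> [c gc] [d hd]; exists (c + d) => a; rewrite expnD leq_mul. Qed.

Lemma pbounded_exp g c : pbounded g -> pbounded (fun a => g a ^ c).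
Proof.
move=> gp; elim: c => [|c IHc]; first exact: (pbounded_const 1).
by apply: pbounded_leq (pbounded_mul gp IHc) => a; rewrite expnS.
Qed.

Lemma pbounded_comp f (T : B -> nat) :
  pbounded T -> pbounded (fun a => esize (f a)) -> pbounded (fun a => T (f a)).
Proof.
move=> [c Tc] fp; apply: (@pbounded_leq _ (fun a => (esize (f a) + 2) ^ c)).
  by move=> a; rewrite addn2.
by apply/pbounded_exp/pbounded_add => //; apply: pbounded_const.
Qed.

(** By [run_size] an output is no longer than the input and the running time together; composition
    relies on this. *)
Lemma ptime_esize f : ptime f -> pbounded (fun a => esize (f a)).
Proof.
move=> [p [T [Tp runp]]].
apply: pbounded_leq (pbounded_add pbounded_esize Tp) => a.
have := run_size 0 (runp a 0 (fun=> [::])).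
by rewrite -[X in st _ _ _ X]/(0 + 0) !st_at.
Qed.

End PolynomialBounds.

Ltac pbound := repeat first
  [ apply: pbounded_add | apply: pbounded_mul | exact: pbounded_const | exact: pbounded_esize
  | assumption | (apply: ptime_esize; assumption) ].

Lemma esize_pair (A B : Type) {cA : code A} {cB : code B} (x : A * B) :
  esize x = 2 * esize x.1 + esize x.2 + 1.
Proof.
rewrite -[LHS]/(size (dbl (encode x.1) ++ encode x.2)) size_cat size_dbl -!/(esize _).
by lia.
Qed.

Lemma esize_nil (A : Type) {cA : code A} : esize (Nil A) = 0.
Proof. by []. Qed.

Lemma esize_cons (A : Type) {cA : code A} (a : A) (l : seq A) :
  esize (a :: l) = 2 * esize a + esize l + 1.
Proof. by rewrite /esize /encode /code_seq /enc_list /= size_cat size_dbl /encode; lia. Qed.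

Lemma esize_cat (A : Type) {cA : code A} (l r : seq A) :
  esize (l ++ r) = esize l + esize r.
Proof. by elim: l => //= a l IHl; rewrite !esize_cons IHl; lia. Qed.

Lemma size_esize (A : Type) {cA : code A} (l : seq A) : size l <= esize l.
Proof. by elim: l => //= a l IHl; rewrite esize_cons; lia. Qed.

Lemma ptime_comp (A B C : Type) {cA : code A} {cB : code B} {cC : code C}
    (g : B -> C) (f : A -> B) : ptime g -> ptime f -> ptime (fun a => g (f a)).
Proof.
move=> [q [U [Up hq]]] fP; have fs := ptime_esize fP; case: fP => p [T [Tp hp]].
exists (fun k => Seq (p k) (q k)), (fun a => T a + U (f a)); split.
  by apply: pbounded_add => //; apply: pbounded_comp.
by move=> a k s; apply: run_seq (hp a k s) (hq _ k s).
Qed.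

Section Combinators.
Context {A B C : Type} {cA : code A} {cB : code B} {cC : code C}.

Lemma ptime_ext (f g : A -> B) : f =1 g -> ptime f -> ptime g.
Proof. by move=> fg [p [T [Tp h]]]; exists p, T; split=> // a k s; rewrite -fg. Qed.

(** A program sees only codes. This passes for free between a number and its list of digits, or an
    integer and its sign and absolute value. *)
Lemma ptime_recode (f : A -> B) (g : A -> C) :
  (forall a, encode (f a) = encode (g a)) -> ptime f -> ptime g.
Proof. by move=> fg [p [T [Tp h]]]; exists p, T; split=> // a k s; rewrite -fg. Qed.

Lemma ptime_id : ptime (fun a : A => a).
Proof.
exists (fun=> Skip), (fun=> 1); split; first exact: pbounded_const.
by move=> a k s; apply: run_skip.
Qed.

Lemma ptime_const (b : B) : ptime (fun _ : A => b).
Proof.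
exists (const_prog (encode b)), (fun a => 2 * esize a + esize b + 2); split; first by pbound.
by move=> a k s; apply: run_const.
Qed.

Lemma ptime_pair (f : A -> B) (g : A -> C) :
  ptime f -> ptime g -> ptime (fun a => (f a, g a)).
Proof.
move=> fP gP; have fs := ptime_esize fP; have gs := ptime_esize gP.
case: fP gP => p [T [Tp hp]] [q [U [Up hq]]].
exists (pair_prog p q),
  (fun a => T a + U a + 20 * (esize a + esize (f a) + esize (g a)) + 20); split.
  by pbound.
by move=> a k s; apply: run_pair; [exact: hp|exact: hq].
Qed.

Lemma ptime_fst (f : A -> B * C) : ptime f -> ptime (fun a => (f a).1).
Proof.
move=> fP; apply: (ptime_comp (g := fst) _ fP).
exists fst_prog, (fun b => 10 * esize b + 8); split; first by pbound.
move=> b k s; apply: run_leq (run_fst k s _ _) _.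
by rewrite [esize b]esize_pair -!/(esize _); lia.
Qed.

Lemma ptime_snd (f : A -> B * C) : ptime f -> ptime (fun a => (f a).2).
Proof.
move=> fP; apply: (ptime_comp (g := snd) _ fP).
exists snd_prog, (fun b => 10 * esize b + 8); split; first by pbound.
move=> b k s; apply: run_leq (run_snd k s _ _) _.
by rewrite [esize b]esize_pair -!/(esize _); lia.
Qed.

Lemma ptime_if (b : A -> bool) (f g : A -> B) :
  ptime b -> ptime f -> ptime g -> ptime (fun a => if b a then f a else g a).
Proof.
move=> [r [V [Vp hr]]] [p [T [Tp hp]]] [q [U [Up hq]]].
exists (if_prog r p q), (fun a => V a + T a + U a + 40 * esize a + 50); split.
  by pbound.
move=> a k s; apply: run_if => [k' s'||].
- exact: (hr a).
- by move=> ->; apply: hp.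
- by move/negbTE->; apply: hq.
Qed.

Lemma ptime_nilp (f : A -> seq B) : ptime f -> ptime (fun a => nilp (f a)).
Proof.
move=> fP; apply: (ptime_comp (g := @nilp B) _ fP).
exists nilp_prog, (fun l => 2 * esize l + 4); split; first by pbound.
move=> l k s; apply: run_eq (run_nilp k s _) _; congr (st _ _ [:: [:: _]]).
by case: l => //= x l; rewrite /nilp /encode /code_seq /enc_list /= size_cat size_dbl addn1.
Qed.

Lemma ptime_head (d : B) (f : A -> seq B) : ptime f -> ptime (fun a => head d (f a)).
Proof.
move=> fP; apply: (ptime_comp (g := head d) _ fP).
exists (head_prog (encode d)), (fun l => 10 * esize l + esize d + 9); split; first by pbound.
case=> [|b l] k s.
  by apply: run_leq (run_head_nil k s _) _; rewrite /esize; lia.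
apply: run_leq (run_head_cons k s _ _ (enc_list (map encode l))) _.
have -> : size (enc_list [seq encode x | x <- l]) = esize l by [].
by rewrite esize_cons /esize; lia.
Qed.

Lemma ptime_behead (f : A -> seq B) : ptime f -> ptime (fun a => behead (f a)).
Proof.
move=> fP; apply: (ptime_comp (g := @behead B) _ fP).
exists snd_prog, (fun l => 10 * esize l + 7); split; first by pbound.
case=> [|b l] k s.
  by apply: run_leq (run_snd_nil k s) _; rewrite /esize; lia.
apply: run_leq (run_snd k s _ _) _.
have -> : size (enc_list [seq encode x | x <- l]) = esize l by [].
by rewrite esize_cons /esize; lia.
Qed.

End Combinators.

(** A pair of an item and a list has the same code as the list with that item in front. *)
Lemma ptime_cons (A B : Type) {cA : code A} {cB : code B} (f : A -> B) (g : A -> seq B) :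
  ptime f -> ptime g -> ptime (fun a => f a :: g a).
Proof. by move=> fP gP; have [p [T [Tp h]]] := ptime_pair fP gP; exists p, T. Qed.

(** Iterating a polynomial-time step may blow the state up exponentially. The bound [B] on all
    intermediate states excludes this and makes every round cost a fixed polynomial in the input. *)
Lemma ptime_foldl (E T S : Type) {cE : code E} {cT : code T} {cS : code S}
    (l : E -> seq T) (a : E -> S) (h : E -> S -> T -> S) (B : E -> nat) :
    ptime l -> ptime a -> ptime (fun p : E * S * T => h p.1.1 p.1.2 p.2) -> pbounded B ->
    (forall e l1 l2, l e = l1 ++ l2 -> esize (foldl (h e) (a e) l1) <= B e) ->
  ptime (fun e => foldl (h e) (a e) (l e)).
Proof.
move=> lP aP hP Bp hB.
(* The loop body receives only an item and a state, so the environment [e] travels inside the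
   state. *)
have [q [U [[c Uc] hq]]] :
    ptime (fun p : T * (E * S) => (p.2.1, h p.2.1 p.2.2 p.1)).
  apply: ptime_pair; first exact/ptime_fst/ptime_snd/ptime_id.
  apply: (ptime_comp hP) (_ : ptime (fun p : T * (E * S) => (p.2, p.1))).
  by apply: ptime_pair; [apply/ptime_snd/ptime_id|apply/ptime_fst/ptime_id].
have [p [V [Vp hp]]] : ptime (fun e => (l e, (e, a e))).
  by apply: ptime_pair => //; apply: ptime_pair => //; apply: ptime_id.
have foldE e r : foldl (fun w x => (w.1, h w.1 w.2 x)) (e, a e) r = (e, foldl (h e) (a e) r).
  by elim/last_ind: r => //= r x IHr; rewrite !foldl_rcons IHr.
have lp := ptime_esize lP; have ap := ptime_esize aP.
(* An argument of the body has code length at most [2 * esize (l e) + 2 * esize e + B e + 2]; [c] is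
   the exponent of its time bound. *)
have [U' Up' U'E] : exists2 U', pbounded U' &
    forall e, U' e = (2 * esize (l e) + 2 * esize e + B e + 4) ^ c.
  by eexists; last by []; apply: pbounded_exp; pbound.
pose F (w : E * S) x := (w.1, h w.1 w.2 x).
have runq e l1 x r : l e = l1 ++ x :: r -> forall k s,
    run (q k) (st k s [:: dbl (encode x) ++ encode (foldl F (e, a e) l1)]) (U' e)
      (st k s [:: encode (F (foldl F (e, a e) l1) x)]).
  move=> le k s; rewrite foldE; apply: run_leq (hq (x, (e, _)) k s) _.
  apply: leq_trans (Uc _) _; rewrite U'E.
  have : (esize (x, (e, foldl (h e) (a e) l1))).+2 <= 2 * esize (l e) + 2 * esize e + B e + 4.
    have := hB _ _ _ le; rewrite le !esize_pair esize_cat esize_cons /=; lia.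
  by case: (c) => // c'; rewrite leq_exp2r.
exists (fun k => Seq (fold_prog p q k) (snd_prog k)).
exists (fun e => (V e + (U' e + 20) * esize (l e) + 40 * (esize (l e) +
   (2 * esize e + esize (a e) + 1) + (2 * esize e + B e + 1)) + 20) +
   (10 * (esize e + B e) + 7)); split.
  by pbound.
move=> e k s; apply: run_seq; last first.
  apply: run_leq (run_snd k s (encode e) (encode (foldl (h e) (a e) (l e)))) _.
  by have := hB e (l e) [::]; rewrite cats0 => /(_ erefl); rewrite /esize; lia.
apply: run_leq.
  have := @run_fold _ _ encode encode _ _ k s _ _ _ (e, a e) _ _ (hp e k s) (runq e).
  by rewrite foldE; apply.
have := hB e (l e) [::]; rewrite cats0 => /(_ erefl) hBe.
have hl := size_esize (l e).
have : (U' e + 20) * size (l e) <= (U' e + 20) * esize (l e) by rewrite leq_mul2l hl orbT.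
have -> : size (encode (e, foldl (h e) (a e) (l e))) = esize (e, foldl (h e) (a e) (l e)) by [].
have -> : size (encode (e, a e)) = esize (e, a e) by [].
rewrite !esize_pair /=.
have -> : size (enc_list [seq encode x | x <- l e]) = esize (l e) by [].
by lia.
Qed.

Section Booleans.
Context {A : Type} {cA : code A}.
Implicit Types b c : A -> bool.

Lemma ptime_negb b : ptime b -> ptime (fun a => ~~ b a).
Proof. by move=> bP; exact: (ptime_if bP (ptime_const _) (ptime_const _)). Qed.

Lemma ptime_andb b c : ptime b -> ptime c -> ptime (fun a => b a && c a).
Proof. by move=> bP cP; exact: (ptime_if bP cP (ptime_const _)). Qed.

Lemma ptime_orb b c : ptime b -> ptime c -> ptime (fun a => b a || c a).
Proof. by move=> bP cP; exact: (ptime_if bP (ptime_const _) cP). Qed.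

Lemma ptime_addb b c : ptime b -> ptime c -> ptime (fun a => b a (+) c a).
Proof. by move=> bP cP; apply: ptime_ext (ptime_if bP (ptime_negb cP) cP) => a; case: (b a). Qed.

End Booleans.

(** A hook, redefined after each new group of closure lemmas. *)
Ltac ptime_more := fail.

Ltac ptime_step := match goal with
  | |- ptime (fun _ => ?c) => exact: (ptime_const c)
  | |- _ => ptime_more
  | h : ptime ?f |- ptime ?f => exact: h
  | |- ptime (pair ?c) => exact: (ptime_pair (ptime_const c) ptime_id)
  | |- ptime fst => exact: (ptime_fst ptime_id)
  | |- ptime snd => exact: (ptime_snd ptime_id)
  | |- ptime (fun a => a) => exact: ptime_id
  | |- ptime (fun _ => ?c) => exact: (ptime_const c)
  | |- ptime (fun a => fst (@?f a)) => refine (ptime_fst (f := f) _)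
  | |- ptime (fun a => snd (@?f a)) => refine (ptime_snd (f := f) _)
  | |- ptime (fun a => (@?f a, @?g a)) => refine (ptime_pair (f := f) (g := g) _ _)
  | |- ptime (fun a => @?f a :: @?g a) => refine (ptime_cons (f := f) (g := g) _ _)
  | |- ptime (fun a => ~~ @?f a) => refine (ptime_negb (b := f) _)
  | |- ptime (fun a => @?f a && @?g a) => refine (ptime_andb (b := f) (c := g) _ _)
  | |- ptime (fun a => @?f a || @?g a) => refine (ptime_orb (b := f) (c := g) _ _)
  | |- ptime (fun a => addb (@?f a) (@?g a)) => refine (ptime_addb (b := f) (c := g) _ _)
  | |- ptime (fun a => nilp (@?f a)) => refine (ptime_nilp (f := f) _)
  | |- ptime (fun a => head ?d (@?f a)) => refine (ptime_head d (f := f) _)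
  | |- ptime (fun a => behead (@?f a)) => refine (ptime_behead (f := f) _)
  | h : ptime ?f |- ptime (fun a => ?f (@?g a)) => refine (ptime_comp (g := f) (f := g) h _)
  | |- ptime (fun a => _) => apply: ptime_if
  end.
Ltac ptime_tac := repeat (cbv beta; ptime_step).

(** * List operations in polynomial time *)

Lemma foldl_cons (T : Type) (l r : seq T) : foldl (fun acc x => x :: acc) r l = rev l ++ r.
Proof. by elim: l r => //= x l IHl r; rewrite IHl rev_cons cat_rcons. Qed.

Lemma esize_rev (T : Type) {cT : code T} (l : seq T) : esize (rev l) = esize l.
Proof.
elim: l => // x l IHl.
by rewrite rev_cons -cats1 esize_cat !esize_cons esize_nil IHl; lia.
Qed.

Lemma ptime_catrev (A T : Type) {cA : code A} {cT : code T} (f g : A -> seq T) :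
  ptime f -> ptime g -> ptime (fun a => rev (f a) ++ g a).
Proof.
move=> fP gP; apply: (ptime_ext (f := fun a => foldl (fun acc x => x :: acc) (g a) (f a))).
  by move=> a; rewrite foldl_cons.
apply: (ptime_foldl (h := fun _ acc x => x :: acc) (B := fun a => esize (f a) + esize (g a)));
  [by []|by []|by ptime_tac|by pbound|].
by move=> a l r ->; rewrite foldl_cons !esize_cat esize_rev; lia.
Qed.

Lemma ptime_rev (A T : Type) {cA : code A} {cT : code T} (f : A -> seq T) :
  ptime f -> ptime (fun a => rev (f a)).
Proof.
move=> fP; apply: (ptime_ext (f := fun a => rev (f a) ++ [::])).
  by move=> a; rewrite cats0.
by apply: ptime_catrev => //; apply: ptime_const.
Qed.

Lemma ptime_cat (A T : Type) {cA : code A} {cT : code T} (f g : A -> seq T) :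
  ptime f -> ptime g -> ptime (fun a => f a ++ g a).
Proof.
move=> fP gP; apply: (ptime_ext (f := fun a => rev (rev (f a)) ++ g a)).
  by move=> a; rewrite revK.
by apply: ptime_catrev => //; apply: ptime_rev.
Qed.

Lemma ptime_flatten (A T : Type) {cA : code A} {cT : code T} (f : A -> seq (seq T)) :
  ptime f -> ptime (fun a => flatten (f a)).
Proof.
have flattenE (l : seq (seq T)) r : foldl cat r l = r ++ flatten l.
  by elim: l r => /= [|x l IHl] r; rewrite ?cats0 // IHl catA.
move=> fP; apply: (ptime_ext (f := fun a => foldl cat [::] (f a))).
  by move=> a; rewrite flattenE.
apply: (ptime_foldl (h := fun _ => cat) (B := fun a => esize (f a)));
  [by []|by ptime_tac|by apply: ptime_cat; ptime_tac|by pbound|].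
move=> a l r ->; rewrite flattenE cat0s esize_cat; apply: leq_trans (leq_addr _ _).
by elim: l => //= x l IHl; rewrite esize_cat esize_cons; lia.
Qed.

(** A fold accumulates the images in reverse: at most [esize (l e)] of them, each of length
    polynomial in that of its argument. *)
Lemma ptime_map (E S T : Type) {cE : code E} {cS : code S} {cT : code T}
    (l : E -> seq S) (f : E -> S -> T) :
    ptime l -> ptime (fun p : E * S => f p.1 p.2) ->
  ptime (fun e => [seq f e x | x <- l e]).
Proof.
move=> lP fP; have lp := ptime_esize lP; have [c fc] := ptime_esize fP.
have mapE e r acc : foldl (fun acc x => f e x :: acc) acc r = rev [seq f e x | x <- r] ++ acc.
  by elim: r acc => //= x r IHr acc; rewrite IHr rev_cons cat_rcons.
apply: (ptime_ext (f := fun e => rev (foldl (fun acc x => f e x :: acc) [::] (l e)))).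
  by move=> e; rewrite mapE cats0 revK.
apply: ptime_rev.
apply: (ptime_foldl (h := fun e acc x => f e x :: acc)
  (B := fun e => esize (l e) * (2 * (2 * esize e + esize (l e) + 3) ^ c + 1))) => //.
- by ptime_tac.
- apply: ptime_cons; last by ptime_tac.
  by apply: (ptime_comp fP) (_ : ptime (fun p : E * seq T * S => (p.1.1, p.2))); ptime_tac.
- by do 8?[apply: pbounded_exp | pbound].
move=> e l1 r ->; rewrite mapE cats0 esize_rev; set m := esize (l1 ++ r).
have h x : esize x <= m -> esize (f e x) <= (2 * esize e + m + 3) ^ c.
  move=> xm; apply: leq_trans (fc (e, x)) _; rewrite esize_pair /=.
  by case: (c) => // c'; rewrite leq_exp2r //; lia.
set K := (_ ^ c) in h *.
apply: (@leq_trans (size l1 * (2 * K + 1))); last first.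
  by rewrite leq_mul2r /m esize_cat (leq_trans (size_esize l1)) ?orbT ?leq_addr.
have {}h x : esize x <= esize l1 -> esize (f e x) <= K.
  by move=> xl; apply: h; rewrite /m esize_cat; lia.
clearbody K; elim: l1 {m} h => //= x l1 IHl h; rewrite esize_cons mulSn.
have := h x; rewrite esize_cons => hx.
have : esize (f e x) <= K by apply: hx; lia.
have {}IH : esize [seq f e x | x <- l1] <= size l1 * (2 * K + 1).
  by apply: IHl => y yl; apply: h; rewrite esize_cons; lia.
by lia.
Qed.

Ltac ptime_lists := match goal with
  | |- ptime (fun a => rev (@?f a)) => refine (ptime_rev (f := f) _)
  | |- ptime (fun a => @?f a ++ @?g a) => refine (ptime_cat (f := f) (g := g) _ _)
  | |- ptime (fun a => flatten (@?f a)) => refine (ptime_flatten (f := f) _)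
  | |- ptime (fun a => [seq @?h a x | x <- @?l a]) => refine (ptime_map (l := l) (f := h) _ _)
  end.
Ltac ptime_more ::= ptime_lists.

Lemma ptime_zip (A S T : Type) {cA : code A} {cS : code S} {cT : code T} (d : T)
    (f : A -> seq S) (g : A -> seq T) :
  ptime f -> ptime g -> ptime (fun a => zip (f a) (g a)).
Proof.
move=> fP gP.
(* The state holds the unread part of the second list and the pairs formed so far, in reverse. *)
pose h (w : seq T * seq (S * T)) x :=
  if nilp w.1 then w else (behead w.1, (x, head d w.1) :: w.2).
have hE l t r : foldl h (t, r) l = (drop (size l) t, rev (zip l t) ++ r).
  elim: l t r => [|x l IHl] [|y t] r //=.
    by rewrite {1}/h /= IHl; case: (l) => //= *; rewrite drop_nil.
  by rewrite {1}/h /= IHl rev_cons cat_rcons.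
apply: (ptime_ext (f := fun a => rev (foldl h (g a, [::]) (f a)).2)).
  by move=> a; rewrite hE /= cats0 revK.
apply/ptime_rev/ptime_snd.
have zip_size (l : seq S) (t : seq T) : esize (zip l t) <= 4 * esize l + 4 * esize t.
  elim: l t => [|x l IHl] [|y t] //=; rewrite !esize_cons esize_pair /=.
  by have := IHl t; lia.
have drop_size n (t : seq T) : esize (drop n t) <= esize t.
  by rewrite -[in X in _ <= X](cat_take_drop n t) esize_cat leq_addl.
apply: (ptime_foldl (h := fun _ => h) (B := fun a => 4 * esize (f a) + 10 * esize (g a) + 1)).
- by [].
- by ptime_tac.
- by rewrite /h; ptime_tac.
- by pbound.
move=> a l r ->; rewrite hE esize_pair /= cats0 esize_rev esize_cat.
by have := zip_size l (g a); have := drop_size (size l) (g a); lia.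
Qed.

(** * Binary arithmetic *)

Lemma binary_digits0 : binary_digits 0 = [::].
Proof. by rewrite /binary_digits up_log1. Qed.

Lemma binary_digitsS n : 0 < n -> binary_digits n = odd n :: binary_digits n./2.
Proof.
move=> n0; rewrite /binary_digits up_log2S //= expn0 divn1; congr cons.
rewrite -[1]/(1 + 0) iotaDl -map_comp; apply: eq_map => i /=.
by rewrite add1n expnS divnMA divn2.
Qed.

(** Expansions have no zero at the most significant end, so [false] in front of the empty expansion
    must disappear. *)
Lemma binary_digits_bcons (b : bool) n :
  binary_digits (b + n.*2) = if (b || (n != 0)) then b :: binary_digits n else [::].
Proof.
case: ifP => [h|/negbT]; last first.
  by rewrite negb_or negbK => /andP[/negbTE-> /eqP->]; rewrite binary_digits0.
rewrite binary_digitsS; last by case: b h => //=; case: n => // n; rewrite doubleS.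
by rewrite oddD odd_double addbF oddb half_bit_double.
Qed.

Definition nbits (n : nat) := size (binary_digits n).

Lemma nbitsE n : nbits n = up_log 2 n.+1.
Proof. by rewrite /nbits size_map size_iota. Qed.

Lemma nbits_leq m n : m <= n -> nbits m <= nbits n.
Proof. by move=> mn; rewrite !nbitsE leq_up_log. Qed.

Lemma nbits_ltn n : n < 2 ^ nbits n.
Proof. by rewrite nbitsE up_logP. Qed.

Lemma nbits_min n k : n < 2 ^ k -> nbits n <= k.
Proof. by move=> nk; rewrite nbitsE up_log_min. Qed.

Lemma nbits_mul m n : nbits (m * n) <= nbits m + nbits n.
Proof.
by apply: nbits_min; rewrite expnD ltn_mul ?nbits_ltn.
Qed.

Lemma nilp_binary_digits n : nilp (binary_digits n) = (n == 0).
Proof. by case: n => [|n]; rewrite ?binary_digits0 // binary_digitsS. Qed.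

Lemma esize_bits (l : seq bool) : esize l = 3 * size l.
Proof.
elim: l => // b l IHl; rewrite esize_cons IHl /=.
by rewrite (_ : esize b = 1) //; lia.
Qed.

Lemma esize_bool (b : bool) : esize b = 1.
Proof. by []. Qed.

Lemma esize_nat n : esize n = 3 * nbits n.
Proof. exact: esize_bits. Qed.

Section NatArithmetic.
Context {A : Type} {cA : code A}.
Implicit Types (f g : A -> nat) (b : A -> bool).

Lemma ptime_binary_digits f : ptime f -> ptime (fun a => binary_digits (f a)).
Proof. exact: ptime_recode. Qed.

Lemma ptime_odd f : ptime f -> ptime (fun a => odd (f a)).
Proof.
move=> fP; apply: ptime_ext (ptime_head false (ptime_binary_digits fP)) => a.
by case: (posnP (f a)) => [->|/binary_digitsS ->]; rewrite ?binary_digits0.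
Qed.

Lemma ptime_half f : ptime f -> ptime (fun a => (f a)./2).
Proof.
move=> fP; apply: ptime_recode (ptime_behead (ptime_binary_digits fP)) => a.
by case: (posnP (f a)) => [->|/binary_digitsS ->]; rewrite ?binary_digits0.
Qed.

Lemma ptime_eq0 f : ptime f -> ptime (fun a => f a == 0).
Proof.
move=> fP; apply: ptime_ext (ptime_nilp (ptime_binary_digits fP)) => a.
exact: nilp_binary_digits.
Qed.

Lemma ptime_bcons b f : ptime b -> ptime f -> ptime (fun a => b a + (f a).*2).
Proof.
move=> bP fP.
apply: (@ptime_recode _ _ _ _ _ _ (fun a =>
  if b a || ~~ (f a == 0) then b a :: binary_digits (f a) else [::])).
  by move=> a; rewrite /encode /code_nat binary_digits_bcons.
apply: ptime_if; [|apply: ptime_cons => //; exact: ptime_binary_digits|exact: ptime_const].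
by apply: ptime_orb => //; apply/ptime_negb/ptime_eq0.
Qed.

End NatArithmetic.

(* The value of a word whose most significant digit comes first. *)
Definition bits_val (l : seq bool) : nat := foldl (fun n (b : bool) => b + n.*2) 0 l.

Lemma bits_val_rcons l b : bits_val (rcons l b) = b + (bits_val l).*2.
Proof. by rewrite /bits_val foldl_rcons. Qed.

Lemma bits_val_cons b l : bits_val (b :: l) = b * 2 ^ size l + bits_val l.
Proof.
elim/last_ind: l => [|l c IHl]; first by rewrite /bits_val /=; lia.
by rewrite -rcons_cons !bits_val_rcons IHl size_rcons expnS; lia.
Qed.

Lemma bits_val_ltn l : bits_val l < 2 ^ size l.
Proof.
elim: l => [|b l IHl] //; rewrite bits_val_cons /= expnS.
by have := leq_b1 b; nia.
Qed.

Lemma bits_val_rev_digits n : bits_val (rev (binary_digits n)) = n.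
Proof.
elim/ltn_ind: n => n IHn; case: (posnP n) => [->|n0]; first by rewrite binary_digits0.
rewrite binary_digitsS // rev_cons bits_val_rcons IHn; first exact: odd_double_half.
by rewrite ltn_half_double -addnn; lia.
Qed.

(** Horner's rule. It also drops leading zeros, which the digits produced by [add_step] may have. *)
Lemma ptime_bits_val (A : Type) {cA : code A} (f : A -> seq bool) :
  ptime f -> ptime (fun a => bits_val (f a)).
Proof.
move=> fP; apply: (ptime_foldl (h := fun _ n (b : bool) => b + n.*2) (B := fun a => esize (f a))).
- by [].
- exact: ptime_const.
- by apply: ptime_bcons; ptime_tac.
- by pbound.
move=> a l r ->; rewrite esize_nat esize_bits size_cat -/(bits_val l).
by have := nbits_min (bits_val_ltn l); lia.
Qed.

Ltac ptime_bits := match goal with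
  | |- ptime (fun a => odd (@?f a)) => refine (ptime_odd (f := f) _)
  | |- ptime (fun a => half (@?f a)) => refine (ptime_half (f := f) _)
  | |- ptime (fun a => @?f a == 0) => refine (ptime_eq0 (f := f) _)
  | |- ptime (fun a => binary_digits (@?f a)) => refine (ptime_binary_digits (f := f) _)
  | |- ptime (fun a => bits_val (@?f a)) => refine (ptime_bits_val (f := f) _)
  end.
Ltac ptime_more ::= first [ptime_lists | ptime_bits].

(* One step of the schoolbook addition ([s = false]) or subtraction ([s = true]) of [y]
   to or from [x]; the state is [(carry, (x, (y, digits of the result so far)))]. *)
Definition add_step (s : bool) (w : bool * (nat * (nat * seq bool))) :=
  let: (c, (x, (y, out))) := w in
  let x0 := s (+) odd x in
  ((c && x0) || (c && odd y) || (x0 && odd y),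
   (x./2, (y./2, (c (+) odd x (+) odd y) :: out))).

(** The loop invariant of schoolbook arithmetic: [x'] and [y'] are the unread parts and the carry or
    borrow [c] has weight [2 ^ n]. Both equations avoid truncated subtraction. *)
Lemma iter_add_step s x y n :
  let: (c, (x', (y', out))) := iter n (add_step s) (false, (x, (y, [::]))) in
  [/\ size out = n, 2 ^ n * x' <= x, 2 ^ n * y' <= y &
      if s then x + 2 ^ n * (c + y') = y + bits_val out + 2 ^ n * x'
      else x + y = bits_val out + 2 ^ n * (c + x' + y')].
Proof.
elim: n => [|n]; first by case: s; split; rewrite ?mul1n //= /bits_val /=; lia.
rewrite iterS; case: (iter n _ _) => [c [x' [y' out]]] /= [so hx hy h].
have ex := odd_double_half x'; have ey := odd_double_half y'.
rewrite bits_val_cons so expnS.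
move: (2 ^ n) hx hy h (x'./2) (y'./2) ex ey => K hx hy h u v ex ey.
move: (bits_val out) h => W h.
rewrite -{}ex -{}ey in hx hy h *; split=> //=; [by nia|by nia|].
by case: s h; case: c; case: (odd x'); case: (odd y') => /= h; nia.
Qed.

Lemma ltn_nbits x y n : nbits x + nbits y <= n -> (x < 2 ^ n) && (y < 2 ^ n).
Proof.
move=> xyn.
by rewrite !(leq_trans (nbits_ltn _)) // leq_pexp2l //; apply: leq_trans xyn;
   rewrite ?leq_addl ?leq_addr.
Qed.

(** The list is a clock: [(nbits x + nbits y).+1] steps read all digits of [x] and [y] and absorb
    the last carry. *)
Definition add_sub (s : bool) (x y : nat) : bool * nat :=
  let w := foldl (fun w _ => add_step s w) (false, (x, (y, [::])))
             (true :: binary_digits x ++ binary_digits y) in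
  (w.1, bits_val w.2.2.2).

Lemma foldl_iter (S T : Type) (f : S -> S) (w : S) (l : seq T) :
  foldl (fun w _ => f w) w l = iter (size l) f w.
Proof. by elim: l w => //= _ l IHl w; rewrite IHl -iterSr. Qed.

(** A borrow that survives the subtraction means [x < y], so one loop yields sum, difference and
    comparison. *)
Lemma add_subP s x y :
  add_sub s x y = if s then (x < y, if x < y then (x + 2 ^ (nbits x + nbits y).+1) - y else x - y)
                  else (false, x + y).
Proof.
rewrite /add_sub foldl_iter /= size_cat -!/(nbits _) -iterS.
set n := (nbits x + nbits y).+1.
have /andP[] : (x < 2 ^ n.-1) && (y < 2 ^ n.-1) by exact: ltn_nbits.
have : 2 ^ n = 2 * 2 ^ n.-1 by rewrite -expnS.
have := iter_add_step s x y n; case: (iter n _ _) => [c [x' [y' out]]] /= [so hx hy].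
have := bits_val_ltn out; rewrite so; move: (2 ^ n) (2 ^ n.-1) hx hy => K K' hx hy wK h KE xK yK.
have {}hx : x' = 0.
  by case: x' hx {wK h} => // u; rewrite mulnS => /(leq_trans (leq_addr _ _)); lia.
have {}hy : y' = 0.
  by case: y' hy {wK h} => // u; rewrite mulnS => /(leq_trans (leq_addr _ _)); lia.
rewrite {}hx {}hy in h; case: s h => h; last first.
  by case: c h => /= h; congr (_, _); lia.
have -> : (x < y) = c by case: c h => /= h; lia.
by case: c h => /= h; congr (_, _); lia.
Qed.

Section NatOperations.
Context {A : Type} {cA : code A}.
Implicit Types (f g : A -> nat) (b : A -> bool).

Lemma ptime_add_sub s f g : ptime f -> ptime g -> ptime (fun a => add_sub s (f a) (g a)).
Proof.
move=> fP gP; have fs := ptime_esize fP; have gs := ptime_esize gP.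
pose l a := true :: binary_digits (f a) ++ binary_digits (g a).
pose w a : bool * (nat * (nat * seq bool)) :=
  foldl (fun w _ => add_step s w) (false, (f a, (g a, [::]))) (l a).
apply: (ptime_ext (f := fun a => ((w a).1, bits_val (w a).2.2.2))) => //.
have wP : ptime w; last by ptime_tac.
apply: (ptime_foldl (l := l) (a := fun a => (false, (f a, (g a, [::]))))
  (h := fun _ (w : bool * (nat * (nat * seq bool))) (_ : bool) => add_step s w)
  (B := fun a => 10 * esize (f a) + 10 * esize (g a) + 10)).
- by rewrite /l; ptime_tac.
- by ptime_tac.
- pose step (w : bool * (nat * (nat * seq bool))) :=
    let c := w.1 in let x := w.2.1 in let y := w.2.2.1 in let out := w.2.2.2 in
    ((c && (s (+) odd x)) || (c && odd y) || ((s (+) odd x) && odd y),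
      (x./2, (y./2, (c (+) odd x (+) odd y) :: out))).
  apply: (ptime_ext (f := fun p => step p.1.2)); first by case=> [[? [? [? []]]]].
  by rewrite /step /=; ptime_tac.
- by pbound.
move=> a l1 l2 la; rewrite foldl_iter.
have : size l1 <= (nbits (f a) + nbits (g a)).+1.
  by have := congr1 size la; rewrite /l /= !size_cat -!/(nbits _); lia.
have := iter_add_step s (f a) (g a) (size l1).
case: (iter _ _ _) => [c [x' [y' out]]] [so hx hy _] hl.
rewrite !esize_pair /= esize_bool !esize_nat esize_bits so.
have : nbits x' <= nbits (f a) by apply/nbits_leq/(leq_trans _ hx); rewrite leq_pmull ?expn_gt0.
have : nbits y' <= nbits (g a) by apply/nbits_leq/(leq_trans _ hy); rewrite leq_pmull ?expn_gt0.
by lia.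
Qed.

Lemma ptime_addn f g : ptime f -> ptime g -> ptime (fun a => f a + g a).
Proof.
move=> fP gP; apply: ptime_ext (ptime_snd (ptime_add_sub false fP gP)) => a.
by rewrite add_subP.
Qed.

Lemma ptime_ltn f g : ptime f -> ptime g -> ptime (fun a => f a < g a).
Proof.
move=> fP gP; apply: ptime_ext (ptime_fst (ptime_add_sub true fP gP)) => a.
by rewrite add_subP.
Qed.

Lemma ptime_subn f g : ptime f -> ptime g -> ptime (fun a => f a - g a).
Proof.
move=> fP gP.
apply: (ptime_ext (f := fun a => if f a < g a then 0 else (add_sub true (f a) (g a)).2)).
  by move=> a; rewrite add_subP /=; case: ltnP => // /ltnW; rewrite -subn_eq0 => /eqP.
apply: ptime_if; [exact: ptime_ltn|exact: ptime_const|exact/ptime_snd/ptime_add_sub].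
Qed.

End NatOperations.

(** Double-and-add along the digits of [g a], most significant first; each intermediate value is
    [f a] times a leading part of [g a], hence short. *)
Lemma ptime_muln (A : Type) {cA : code A} (f g : A -> nat) :
  ptime f -> ptime g -> ptime (fun a => f a * g a).
Proof.
move=> fP gP.
have mulE x l : foldl (fun n (b : bool) => n.*2 + (if b then x else 0)) 0 l = x * bits_val l.
  elim/last_ind: l => [|l b IHl]; first by rewrite muln0.
  by rewrite foldl_rcons IHl bits_val_rcons; case: b; lia.
apply: (ptime_ext (f := fun a => foldl (fun n (b : bool) => n.*2 + (if b then f a else 0)) 0
  (rev (binary_digits (g a))))).
  by move=> a; rewrite mulE bits_val_rev_digits.
have [fs gs] := (ptime_esize fP, ptime_esize gP).
apply: (ptime_foldl (h := fun a n (b : bool) => n.*2 + (if b then f a else 0))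
  (B := fun a => esize (f a) + esize (g a))).
- by ptime_tac.
- by ptime_tac.
- apply: ptime_addn.
    apply: (ptime_ext (f := fun p : A * nat * bool => p.1.2 + p.1.2)).
      by move=> p; rewrite addnn.
    by apply: ptime_addn; ptime_tac.
  apply: ptime_if; [by ptime_tac| |exact: ptime_const].
  by apply: (ptime_comp (g := f) fP); ptime_tac.
- by pbound.
move=> a l r la; rewrite mulE !esize_nat.
have : nbits (bits_val l) <= nbits (g a).
  have := nbits_min (bits_val_ltn l); have := congr1 size la.
  by rewrite size_rev size_cat -/(nbits _); lia.
by have := nbits_mul (f a) (bits_val l); lia.
Qed.

(** * Integers *)

Definition mkint (s : bool) (n : nat) : int := (if s then - n%:Z else n%:Z)%R.

Lemma mkint_abs (z : int) : mkint (z < 0)%R `|z| = z.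
Proof. by rewrite /mkint; case: ifP; lia. Qed.

Section IntOperations.
Context {A : Type} {cA : code A}.
Implicit Types (f g : A -> int) (b : A -> bool).

Lemma ptime_sign_abs f : ptime f -> ptime (fun a => ((f a < 0)%R, `|f a|)).
Proof. exact: ptime_recode. Qed.

Lemma ptime_lt0z f : ptime f -> ptime (fun a => (f a < 0)%R).
Proof. by move=> fP; apply: ptime_ext (ptime_fst (ptime_sign_abs fP)). Qed.

Lemma ptime_absz f : ptime f -> ptime (fun a => `|f a|).
Proof. by move=> fP; apply: ptime_ext (ptime_snd (ptime_sign_abs fP)). Qed.

Lemma ptime_mkint b (f : A -> nat) : ptime b -> ptime f -> ptime (fun a => mkint (b a) (f a)).
Proof.
move=> bP fP; apply: (@ptime_recode _ _ _ _ _ _ (fun a => (b a && ~~ (f a == 0), f a))).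
  move=> a.
  have e : (b a && ~~ (f a == 0), f a) = ((mkint (b a) (f a) < 0)%R, `|mkint (b a) (f a)|).
    by rewrite /mkint; case: (b a); congr (_, _); lia.
  exact: (congr1 encode e).
apply: ptime_pair => //; apply: ptime_andb => //; exact/ptime_negb/ptime_eq0.
Qed.

Lemma ptime_Posz (f : A -> nat) : ptime f -> ptime (fun a => (f a)%:Z%R).
Proof. by move=> fP; apply: ptime_ext (ptime_mkint (ptime_const false) fP). Qed.

Lemma ptime_eq0z f : ptime f -> ptime (fun a => f a == 0%R).
Proof.
by move=> fP; apply: ptime_ext (ptime_eq0 (ptime_absz fP)) => a; rewrite absz_eq0.
Qed.

Lemma ptime_le0z f : ptime f -> ptime (fun a => (f a <= 0)%R).
Proof.
move=> fP; apply: ptime_ext (ptime_orb (ptime_lt0z fP) (ptime_eq0z fP)) => a.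
by rewrite le_eqVlt orbC.
Qed.

Lemma ptime_oppz f : ptime f -> ptime (fun a => (- f a)%R).
Proof.
move=> fP; apply: ptime_ext (ptime_mkint (ptime_negb (ptime_lt0z fP)) (ptime_absz fP)) => a.
by rewrite /mkint; case: (boolP (f a < 0)%R) => h /=; lia.
Qed.

Lemma ptime_mulz f g : ptime f -> ptime g -> ptime (fun a => (f a * g a)%R).
Proof.
move=> fP gP; apply: ptime_ext (ptime_mkint (ptime_addb (ptime_lt0z fP) (ptime_lt0z gP))
  (ptime_muln (ptime_absz fP) (ptime_absz gP))) => a.
by rewrite /mkint; case: (boolP (f a < 0)%R); case: (boolP (g a < 0)%R) => /=; nia.
Qed.

Lemma ptime_addz f g : ptime f -> ptime g -> ptime (fun a => (f a + g a)%R).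
Proof.
move=> fP gP.
have [sf sg] := (ptime_lt0z fP, ptime_lt0z gP).
have [nf ng] := (ptime_absz fP, ptime_absz gP).
apply: ptime_ext (ptime_if (ptime_addb sf sg)
  (ptime_if (ptime_ltn nf ng)
     (ptime_mkint sg (ptime_subn ng nf)) (ptime_mkint sf (ptime_subn nf ng)))
  (ptime_mkint sf (ptime_addn nf ng))) => a.
by rewrite /mkint; case: (boolP (f a < 0)%R); case: (boolP (g a < 0)%R) => hg hf /=;
  (try case: ltnP) => *; lia.
Qed.

Lemma ptime_sgz f : ptime f -> ptime (fun a => sgz (f a)).
Proof.
move=> fP; apply: ptime_ext (ptime_if (ptime_eq0z fP) (ptime_const 0%R)
  (ptime_if (ptime_lt0z fP) (ptime_const (-1)%R) (ptime_const 1%R))) => a.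
by rewrite /sgz.
Qed.

End IntOperations.

Ltac ptime_ints := match goal with
  | |- ptime (fun a => @?f a + @?g a) => refine (ptime_addn (f := f) (g := g) _ _)
  | |- ptime (fun a => @?f a * @?g a) => refine (ptime_muln (f := f) (g := g) _ _)
  | |- ptime (fun a => (@?f a + @?g a)%R) => refine (ptime_addz (f := f) (g := g) _ _)
  | |- ptime (fun a => (@?f a * @?g a)%R) => refine (ptime_mulz (f := f) (g := g) _ _)
  | |- ptime (fun a => (- @?f a)%R) => refine (ptime_oppz (f := f) _)
  | |- ptime (fun a => sgz (@?f a)) => refine (ptime_sgz (f := f) _)
  | |- ptime (fun a => `|@?f a|) => refine (ptime_absz (f := f) _)
  | |- ptime (fun a => Posz (@?f a)) => refine (ptime_Posz (f := f) _)
  | |- ptime (fun a => (@?f a < 0)%R) => refine (ptime_lt0z (f := f) _)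
  | |- ptime (fun a => (@?f a <= 0)%R) => refine (ptime_le0z (f := f) _)
  | |- ptime (fun a => @?f a == 0%R) => refine (ptime_eq0z (f := f) _)
  | |- ptime (fun a => mkint (@?b a) (@?f a)) => refine (ptime_mkint (b := b) (f := f) _ _)
  end.
Ltac ptime_more ::= first [ptime_lists | ptime_bits | ptime_ints].

(** * Affine forms *)

(* [(b, [:: c_1; ..; c_m])] stands for the affine form [b + c_1 x_1 + .. + c_m x_m]. *)
Definition affine : Type := int * seq int.

Definition coef (f : affine) : int := head 0%R f.2.
Definition rest (f : affine) : affine := (f.1, behead f.2).

(* [|coef f|] times the value of [g] at the zero of [f] translated by [t]; with [e = 1] its
   sign is the one just after that point, as the value is an integer. *)
Definition subst (t e : int) (f g : affine) : affine :=
  let m := (`|coef f|%N%:Z)%R in let m' := (- (sgz (coef f) * coef g))%R in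
  ((m * g.1 + m' * f.1 + m * coef g * t + (if (- coef g < 0)%R then e else 0))%R,
   [seq (m * p.1 + m' * p.2)%R | p <- zip (behead g.2) (behead f.2)]).

(** As the first variable tends to -oo, a form containing it takes the sign of [- coef f], kept here
    as a constant form. *)
Definition at_ninfty (f : affine) : affine :=
  if coef f == 0%R then rest f else ((- coef f)%R, [seq 0%R | _ <- behead f.2]).

Definition samples (ts : seq (int * int)) (H : seq affine) : seq (seq affine) :=
  [seq at_ninfty f | f <- H] ::
  flatten [seq [seq [seq subst te.1 te.2 f g | g <- H] | f <- H] | te <- ts].

(** Zero coefficients count as 1, which makes this a positive common multiple of the nonzero ones. A
    least common multiple would be smaller, but the product already has linearly many digits. *)
Definition coef_prod (H : seq affine) : nat :=
  foldl muln 1 [seq (if `|coef f| == 0 then 1 else `|coef f|) | f <- H].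

(* The new modulus is a multiple of every [M * coef f] and greater than every
   [2 * M * |coef f * coef g|]. *)
Definition eliminate (MH : nat * seq affine) : nat * seq affine :=
  (3 * MH.1 * (coef_prod MH.2 * coef_prod MH.2),
   flatten (samples [:: (MH.1%:Z, 0); (- MH.1%:Z, 0)]%R MH.2)).

Definition refine_samples (Hs : seq (seq affine)) : seq (seq affine) :=
  flatten [seq samples [:: (0%R, 0%R); (0%R, 1%R)] H | H <- Hs].

Lemma ptime_coef (A : Type) {cA : code A} (f : A -> affine) :
  ptime f -> ptime (fun a => coef (f a)).
Proof. by move=> fP; rewrite /coef; ptime_tac. Qed.

Ltac ptime_coefs := match goal with
  | |- ptime (fun a => coef (@?f a)) => refine (ptime_coef (f := f) _)
  end.
Ltac ptime_more ::= first [ptime_lists | ptime_bits | ptime_ints | ptime_coefs].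

Lemma ptime_subst (A : Type) {cA : code A} (t e : A -> int) (f g : A -> affine) :
  ptime t -> ptime e -> ptime f -> ptime g -> ptime (fun a => subst (t a) (e a) (f a) (g a)).
Proof.
move=> tP eP fP gP; rewrite /subst /=; ptime_tac.
by apply: (ptime_zip 0%R); ptime_tac.
Qed.

Lemma ptime_at_ninfty (A : Type) {cA : code A} (f : A -> affine) :
  ptime f -> ptime (fun a => at_ninfty (f a)).
Proof. by move=> fP; rewrite /at_ninfty /rest; ptime_tac. Qed.

Ltac ptime_substs := match goal with
  | |- ptime (fun a => at_ninfty (@?f a)) => refine (ptime_at_ninfty (f := f) _)
  | |- ptime (fun a => subst (@?t a) (@?e a) (@?f a) (@?g a)) =>
      refine (ptime_subst (t := t) (e := e) (f := f) (g := g) _ _ _ _)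
  end.
Ltac ptime_more ::= first [ptime_lists | ptime_bits | ptime_ints | ptime_coefs | ptime_substs].

Lemma ptime_samples (A : Type) {cA : code A} (ts : A -> seq (int * int)) (H : A -> seq affine) :
  ptime ts -> ptime H -> ptime (fun a => samples (ts a) (H a)).
Proof. by move=> tP hP; rewrite /samples; ptime_tac. Qed.

Lemma ptime_coef_prod (A : Type) {cA : code A} (H : A -> seq affine) :
  ptime H -> ptime (fun a => coef_prod (H a)).
Proof.
move=> HP; have gP : ptime (fun a =>
  [seq (if `|coef f| == 0 then 1 else `|coef f|) | f <- H a]) by ptime_tac.
(* Digits of a product are at most those of its factors together; the 3 is [esize 1], for the empty
   product. *)
apply: (ptime_foldl (h := fun _ => muln) (B := fun a => esize
  [seq (if `|coef f| == 0 then 1 else `|coef f|) | f <- H a] + 3)).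
- by [].
- by ptime_tac.
- by apply: ptime_muln; ptime_tac.
- by apply: pbounded_add; [apply: ptime_esize|apply: pbounded_const].
move=> a l r ->; rewrite esize_cat; apply: (@leq_trans (esize l + 3)); last by lia.
elim/last_ind: l {r} => // l n IHl.
rewrite foldl_rcons -cats1 esize_cat esize_cons esize_nil !esize_nat in IHl *.
by have := nbits_mul (foldl muln 1 l) n; lia.
Qed.

Lemma ptime_eliminate (A : Type) {cA : code A} (MH : A -> nat * seq affine) :
  ptime MH -> ptime (fun a => eliminate (MH a)).
Proof.
move=> mP; rewrite /eliminate; ptime_tac; try by apply: ptime_coef_prod; ptime_tac.
by apply: ptime_samples; ptime_tac.
Qed.

Lemma ptime_refine_samples (A : Type) {cA : code A} (Hs : A -> seq (seq affine)) :
  ptime Hs -> ptime (fun a => refine_samples (Hs a)).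
Proof.
by move=> hP; rewrite /refine_samples; ptime_tac; apply: ptime_samples; ptime_tac.
Qed.

(** * Decoding formulas and encoding decompositions *)

Lemma ptime_enc_seq (E S : Type) {cE : code E} {cS : code S} (l : E -> seq S)
    (enc : E -> S -> seq bool) :
    ptime l -> ptime (fun p : E * S => enc p.1 p.2) ->
  ptime (fun e => enc_seq (enc e) (l e)).
Proof.
move=> lP encP; rewrite /enc_seq; apply: ptime_cat; last exact: ptime_const.
apply: ptime_flatten; apply: ptime_map => //.
by apply: ptime_cons => //; apply: ptime_const.
Qed.

Lemma ptime_enc_int (A : Type) {cA : code A} (f : A -> int) :
  ptime f -> ptime (fun a => enc_int (f a)).
Proof.
move=> fP; rewrite /enc_int; ptime_tac; rewrite /enc_nat.
by apply: (ptime_enc_seq (enc := fun _ b => [:: b])); ptime_tac.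
Qed.

Definition enc_ints (s : seq int) : seq bool := flatten [seq enc_int z | z <- s].

(* The second form of the pair is a constant, whose sign is required of the first one. *)
Definition cell_inequality (p : affine * affine) : seq int * int :=
  if (p.2.1 <= 0)%R then (rev p.1.2, (- p.1.1)%R)
  else ([seq (- c)%R | c <- rev p.1.2], (p.1.1 + -1)%R).

Definition scalar_entries (d M : nat) : seq int :=
  [seq if b then Posz M else 0%R | b <- flatten [seq [seq i == j | j <- iota 0 d] | i <- iota 0 d]].

(** The output word, written from lists of integers instead of matrices; [enc_decomposition_cells]
    identifies it with the required encoding. *)
Definition enc_cells (d : nat) (D : nat * seq affine * seq (seq affine)) : seq bool :=
  enc_seq (fun L : seq affine =>
    enc_seq (fun p => enc_ints (cell_inequality p).1 ++ enc_int (cell_inequality p).2)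
        (zip D.1.2 L)
      ++ enc_ints (scalar_entries d D.1.1)) D.2.

Lemma ptime_enc_cells (A : Type) {cA : code A} d (D : A -> nat * seq affine * seq (seq affine)) :
  ptime D -> ptime (fun a => enc_cells d (D a)).
Proof.
move=> DP.
have intsP : ptime enc_ints.
  by rewrite /enc_ints; ptime_tac; apply: ptime_enc_int; ptime_tac.
have ineqP : ptime cell_inequality by rewrite /cell_inequality; ptime_tac.
rewrite /enc_cells.
apply: (ptime_enc_seq (l := fun a => (D a).2) (enc := fun a (L : seq affine) =>
    enc_seq (fun p => enc_ints (cell_inequality p).1 ++ enc_int (cell_inequality p).2)
        (zip (D a).1.2 L)
      ++ enc_ints (scalar_entries d (D a).1.1))); first by ptime_tac.
ptime_tac; last by rewrite /scalar_entries; ptime_tac.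
apply: (ptime_enc_seq (enc := fun _ p =>
  enc_ints (cell_inequality p).1 ++ enc_int (cell_inequality p).2)).
  by apply: (ptime_zip (0%R, [::])); ptime_tac.
by ptime_tac; apply: ptime_enc_int; ptime_tac.
Qed.

(* The state is [(finished, (digits read, remaining word))]. *)
Definition read_digit (w : bool * (seq bool * seq bool)) :=
  if w.1 then w
  else if head false w.2.2
    then (false, (head false (behead w.2.2) :: w.2.1, behead (behead w.2.2)))
    else (true, (w.2.1, behead w.2.2)).

(** The word is its own clock, and the flag makes surplus steps idle. Digits arrive least
    significant first, so the accumulator has the order that [bits_val] expects. *)
Definition read_nat (w : seq bool) : nat * seq bool :=
  let r := foldl (fun s _ => read_digit s) (false, ([::], w)) w in (bits_val r.2.1, r.2.2).

Arguments read_nat : simpl never.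

Lemma iter_read_digit_done n acc w :
  iter n read_digit (true, (acc, w)) = (true, (acc, w)).
Proof. by elim: n => //= n ->. Qed.

Lemma read_nat_enc m r : read_nat (enc_nat m ++ r) = (m, r).
Proof.
rewrite /read_nat foldl_iter.
suff -> : iter (size (enc_nat m ++ r)) read_digit (false, ([::], enc_nat m ++ r)) =
    (true, (rev (binary_digits m), r)) by rewrite /= bits_val_rev_digits.
rewrite /enc_nat; move: (binary_digits m) => l.
have sizeE : size (enc_seq (fun b : bool => [:: b]) l) = (2 * size l).+1.
  by rewrite /enc_seq size_cat addn1; elim: l => //= b l [->]; lia.
have -> : size (enc_seq (fun b : bool => [:: b]) l ++ r) = (size l + size r) + (size l).+1.
  by rewrite size_cat sizeE; lia.
suff E acc : iter (size l).+1 read_digit (false, (acc, enc_seq (fun b => [:: b]) l ++ r)) =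
    (true, (rev l ++ acc, r)) by rewrite iterD E cats0 iter_read_digit_done.
elim: l acc {sizeE} => [|b l IHl] acc //.
rewrite iterSr (_ : read_digit _ = (false, (b :: acc, enc_seq (fun b => [:: b]) l ++ r))) //.
by rewrite IHl rev_cons cat_rcons.
Qed.

Lemma iter_read_digit_size n acc w :
  let r := iter n read_digit (false, (acc, w)) in size r.2.1 + size r.2.2 <= size acc + size w.
Proof.
elim: n => //= n; case: (iter _ _ _) => [b [acc' w']] /= IHn; rewrite /read_digit /=.
case: b => //; case: w' IHn => [|[] [|c w']] /=; lia.
Qed.

Lemma read_nat_size w : nbits (read_nat w).1 + size (read_nat w).2 <= size w.
Proof.
rewrite /read_nat foldl_iter; have := iter_read_digit_size (size w) [::] w.
case: (iter _ _ _) => [b [acc w']] /=; have := nbits_min (bits_val_ltn acc); lia.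
Qed.

Lemma ptime_read_nat (A : Type) {cA : code A} (f : A -> seq bool) :
  ptime f -> ptime (fun a => read_nat (f a)).
Proof.
move=> fP; apply: (ptime_comp (g := read_nat) _ fP); rewrite /read_nat.
have rP : ptime (fun w : seq bool =>
    foldl (fun s _ => read_digit s) (false, ([::] : seq bool, w)) w).
  apply: (ptime_foldl (h := fun _ s (_ : bool) => read_digit s) (B := fun w => 9 * esize w + 10)).
  - exact: ptime_id.
  - by ptime_tac.
  - by rewrite /read_digit; ptime_tac.
  - by pbound.
  move=> w l r ->; rewrite foldl_iter; have := iter_read_digit_size (size l) [::] (l ++ r).
  case: (iter _ _ _) => [b [acc w']] /=; rewrite !esize_pair /= esize_bool !esize_bits; lia.
by ptime_tac.
Qed.

Definition read_int (w : seq bool) : int * seq bool :=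
  let r := read_nat (behead w) in (mkint (head false w) r.1, r.2).

Arguments read_int : simpl never.

Lemma read_int_enc z r : read_int (enc_int z ++ r) = (z, r).
Proof. by rewrite /read_int /enc_int cat_cons [behead _]/= read_nat_enc mkint_abs. Qed.

Lemma read_int_size w : nbits `|(read_int w).1| + size (read_int w).2 <= size w.
Proof.
rewrite /read_int -[_.1]/(mkint _ _) -[X in size X]/(read_nat (behead w)).2.
have := read_nat_size (behead w); rewrite size_behead.
have -> : `|mkint (head false w) (read_nat (behead w)).1| = (read_nat (behead w)).1.
  by rewrite /mkint; case: ifP => _; lia.
by lia.
Qed.

Lemma ptime_read_int (A : Type) {cA : code A} (f : A -> seq bool) :
  ptime f -> ptime (fun a => read_int (f a)).
Proof.
move=> fP; have rP : ptime (fun a => read_nat (behead (f a))).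
  by apply: ptime_read_nat; ptime_tac.
by rewrite /read_int; ptime_tac.
Qed.

(** The number of iterations is a constant independent of the input: this is where fixing the number
    of variables enters. *)
Lemma ptime_iter (A B : Type) {cA : code A} {cB : code B} n (h : B -> B) (f : A -> B) :
  ptime h -> ptime f -> ptime (fun a => iter n h (f a)).
Proof. by move=> hP fP; elim: n => //= n IHn; apply: (ptime_comp hP). Qed.

Definition push_int (w : seq int * seq bool) : seq int * seq bool :=
  ((read_int w.2).1 :: w.1, (read_int w.2).2).

(** The integers are stacked last first: the head is the right-hand side, moved to the left with a
    minus sign, and then come the coefficients, innermost variable first. *)
Definition read_form (n : nat) (w : seq bool) : affine * seq bool :=
  let r := iter n push_int ([::], w) in (((- head 0%R r.1)%R, behead r.1), r.2).

Lemma iter_push_int_enc (s acc : seq int) r :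
  iter (size s) push_int (acc, enc_ints s ++ r) = (rev s ++ acc, r).
Proof.
elim: s acc => // z s IHs acc.
rewrite [size _]/= iterSr (_ : push_int _ = (z :: acc, enc_ints s ++ r)).
  by rewrite IHs rev_cons cat_rcons.
by rewrite /push_int [enc_ints _]/= -catA read_int_enc.
Qed.

Lemma esize_int (z : int) : esize z = 3 * nbits `|z| + 3.
Proof.
have -> : esize z = esize ((z < 0)%R, `|z|) by [].
by rewrite esize_pair /= esize_bool esize_nat; lia.
Qed.

Arguments read_form : simpl never.

(** As an item of a list an integer costs 6 per binary digit plus 7, and each digit is paid for by a
    symbol consumed. Malformed words are covered, since a time bound must hold on every word. *)
Lemma read_form_size n w :
  esize (read_form n w).1 + 6 * size (read_form n w).2 <= 6 * size w + 7 * n + 10.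
Proof.
rewrite /read_form; set r := iter _ _ _.
have : esize r.1 + 6 * size r.2 <= 6 * size w + 7 * n.
  rewrite /r {r}; elim: n => [|n IHn]; first by rewrite /= esize_nil; lia.
  rewrite iterS; move: (iter _ _ _) IHn => [acc w'] /= IHn.
  move: (read_int_size w'); rewrite /push_int /=; case: (read_int w') => z w'' /=.
  by rewrite esize_cons esize_int; lia.
case: r => [[|z acc] w'] /=; rewrite esize_pair /= esize_int ?esize_cons ?esize_int ?abszN //.
  by rewrite (_ : nbits `|0%R| = 0) ?esize_nil; [lia|rewrite nbitsE up_log1].
by lia.
Qed.

Lemma read_form_size_rest n w : size (read_form n w).2 <= size w.
Proof.
rewrite /read_form; elim: n => // n; rewrite iterS; case: (iter _ _ _) => [acc w'] IHn.
exact: leq_trans (leq_trans (leq_addl _ _) (read_int_size w')) IHn.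
Qed.

Lemma ptime_read_form (A : Type) {cA : code A} n (f : A -> seq bool) :
  ptime f -> ptime (fun a => read_form n (f a)).
Proof.
move=> fP; have rP : ptime (fun a => iter n push_int ([::], f a)).
  apply: ptime_iter; last by ptime_tac.
  have iP := ptime_read_int (ptime_snd (ptime_id (A := seq int * seq bool))).
  by rewrite /push_int; ptime_tac.
by rewrite /read_form; ptime_tac.
Qed.

(* A formula is read as a sequence of symbols, of which only the inequalities are kept. *)
Definition read_symbol (n : nat) (w : seq affine * seq bool) : seq affine * seq bool :=
  if nilp w.2 then w
  else if ~~ head false w.2 && ~~ head false (behead w.2)
    then ((read_form n (behead (behead w.2))).1 :: w.1, (read_form n (behead (behead w.2))).2)
    else (w.1, behead (behead w.2)).

Definition read_forms (n : nat) (w : seq bool) : seq affine :=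
  (foldl (fun s _ => read_symbol n s) ([::], w) w).1.

Lemma ptime_read_forms (A : Type) {cA : code A} n (f : A -> seq bool) :
  ptime f -> ptime (fun a => read_forms n (f a)).
Proof.
move=> fP; apply: (ptime_comp (g := read_forms n) _ fP); apply: ptime_fst.
apply: (ptime_foldl (h := fun _ s (_ : bool) => read_symbol n s)
  (B := fun w => 2 * ((33 + 14 * n) * esize w) + 3 * esize w + 1)).
- exact: ptime_id.
- by ptime_tac.
- by rewrite /read_symbol; ptime_tac; apply: ptime_read_form; ptime_tac.
- by pbound.
move=> w l r; set K := 33 + 14 * n => ->; rewrite foldl_iter.
(* A potential argument: each symbol consumed pays 12 for the digit it may encode and [21 + 14 * n]
   for the overhead of a form, whence [K]. *)
have : esize (iter (size l) (read_symbol n) ([::], l ++ r)).1 +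
    K * size (iter (size l) (read_symbol n) ([::], l ++ r)).2 <= K * size (l ++ r).
  elim: (size l) => // m; rewrite iterS; case: (iter _ _ _) => [H w'].
  rewrite /read_symbol [(H, w').1]/= [(H, w').2]/=.
  case: w' => [|b w'] // IHm; rewrite [nilp _]/= [behead (b :: w')]/=.
  have Kw p : p <= (size w').+1 -> K * p <= K * (size w').+1.
    by move=> h; rewrite leq_mul2l h orbT.
  case: ifP => _; last by have := Kw (size (behead w')); rewrite size_behead /= in IHm *; lia.
  have := read_form_size n (behead w'); have := read_form_size_rest n (behead w').
  rewrite size_behead; case: (read_form _ _) => [h w''] /= w1 w2; rewrite /= in IHm.
  have KE p : K * p = 12 * p + (21 + 14 * n) * p by rewrite -mulnDl.
  have : (21 + 14 * n) * size w'' <= (21 + 14 * n) * size w' by rewrite leq_mul2l; lia.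
  by move: IHm; rewrite esize_cons KE [K * size w'']KE mulnS; lia.
case: (iter _ _ _) => [H w'] /=; rewrite esize_pair /= !esize_bits.
have : size w' <= K * size w' by rewrite leq_pmull.
by lia.
Qed.

Local Open Scope ring_scope.

(** * Elimination of variables *)

Fixpoint dot (r x : seq int) : int :=
  if (r, x) is (c :: r', y :: x') then c * y + dot r' x' else 0.

Definition eval (f : affine) (x : seq int) : int := f.1 + dot f.2 x.

Definition sized (m : nat) (H : seq affine) : bool := all (fun f => size f.2 == m) H.

Definition congr_mod (M : nat) (x x' : seq int) : Prop :=
  size x = size x' /\ forall i, (M %| x`_i - x'`_i)%Z.

Definition agree (MH : nat * seq affine) (x x' : seq int) : Prop :=
  congr_mod MH.1 x x' /\ forall f, f \in MH.2 -> (eval f x <= 0) = (eval f x' <= 0).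

Lemma dot_comb (a b : int) (r r' x : seq int) : size r = size r' ->
  dot [seq a * p.1 + b * p.2 | p <- zip r r'] x = a * dot r x + b * dot r' x.
Proof.
elim: r r' x => [|c r IHr] [|c' r'] [|y x] //= h; rewrite ?mulr0 ?addr0 //.
by case: h => /IHr ->; ring.
Qed.

Lemma dot0 (r x : seq int) : dot [seq 0 | _ <- r] x = 0.
Proof. by elim: r x => [|c r IHr] [|y x] //=; rewrite IHr mul0r addr0. Qed.

Lemma dot_congr (M : nat) (r x x' : seq int) : congr_mod M x x' -> (M %| dot r x - dot r x')%Z.
Proof.
elim: r x x' => [|c r IHr] [|y x] [|y' x'] [] //= [sx] d; try by rewrite subrr dvdz0.
have -> : c * y + dot r x - (c * y' + dot r x') = c * (y - y') + (dot r x - dot r x') by ring.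
apply: rpredD; first by rewrite dvdz_mull //; apply: (d 0%N).
by apply: IHr; split=> // i; apply: (d i.+1).
Qed.

Lemma eval_coef f y x : eval f (y :: x) = coef f * y + eval (rest f) x.
Proof. by case: f => b [|c r]; rewrite /eval /coef /rest /=; ring. Qed.

(** Adding [e = 1] makes the integer value 0, and no other, pass from nonpositive to positive, as
    happens just after the point for increasing [g]. For other [g] the test [<= 0] does not change
    there. *)
Lemma eval_subst t e f g x : size (behead g.2) = size (behead f.2) ->
  eval (subst t e f g) x = `|coef f| * eval (rest g) x - sgz (coef f) * coef g * eval (rest f) x +
    `|coef f| * coef g * t + (if 0 < coef g then e else 0).
Proof.
by move=> h; rewrite /eval /subst /rest /= dot_comb // oppr_lt0 abszE; ring.
Qed.

Lemma eval_at_ninfty f x :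
  eval (at_ninfty f) x = if coef f == 0 then eval (rest f) x else - coef f.
Proof. by rewrite /at_ninfty; case: ifP => // _; rewrite /eval /= dot0 addr0. Qed.

Lemma size_subst t e f g : size (behead g.2) = size (behead f.2) ->
  size (subst t e f g).2 = size (behead f.2).
Proof. by move=> h; rewrite size_map size_zip h minnn. Qed.

Lemma size_at_ninfty f : size (at_ninfty f).2 = size (behead f.2).
Proof. by rewrite /at_ninfty; case: ifP => // _; rewrite size_map. Qed.

Lemma mem_samples ts H L : L \in samples ts H ->
  L = [seq at_ninfty f | f <- H] \/
  exists te f, [/\ te \in ts, f \in H & L = [seq subst te.1 te.2 f g | g <- H]].
Proof.
rewrite inE => /orP[/eqP ->|/flattenP[? /mapP[te tet ->] /mapP[f fH ->]]]; first by left.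
by right; exists te, f.
Qed.

Lemma samples_ninfty ts H : [seq at_ninfty f | f <- H] \in samples ts H.
Proof. by rewrite inE eqxx. Qed.

Lemma samples_subst ts H te f : te \in ts -> f \in H ->
  [seq subst te.1 te.2 f g | g <- H] \in samples ts H.
Proof.
move=> tet fH; rewrite inE; apply/orP; right; apply/flattenP.
by exists [seq [seq subst te.1 te.2 f g | g <- H] | f <- H]; apply: map_f.
Qed.

Lemma sized_samples m ts H : sized m.+1 H -> all (sized m) (samples ts H).
Proof.
move=> /allP hH; apply/allP => L /mem_samples [->|[te [f [_ fH ->]]]];
  apply/allP => _ /mapP[g gH ->]; apply/eqP.
  by rewrite size_at_ninfty size_behead (eqP (hH g gH)).
by rewrite size_subst !size_behead (eqP (hH _ fH)) ?(eqP (hH _ gH)).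
Qed.

Lemma sized_eliminate m MH : sized m.+1 MH.2 -> sized m (eliminate MH).2.
Proof.
move=> h; apply/allP => f /flattenP[L].
by move/(allP (sized_samples _ h))/allP => hL; apply: hL.
Qed.

Lemma coef_prodE H :
  coef_prod H = (\prod_(f <- H) (if `|coef f|%N == 0%N then 1%N else `|coef f|%N))%N.
Proof.
rewrite /coef_prod.
rewrite -(big_map (fun f => if `|coef f|%N == 0%N then 1%N else `|coef f|%N) xpredT id) /=.
elim/last_ind: (map _ _) => [|l n IHl]; first by rewrite big_nil.
by rewrite foldl_rcons IHl big_rcons /= mulnC.
Qed.

Lemma coef_prod_gt0 H : (0 < coef_prod H)%N.
Proof. by rewrite coef_prodE prodn_gt0 // => f; case: eqP => // /eqP; lia. Qed.

Lemma dvdn_coef_prod H f : f \in H -> coef f != 0 -> (`|coef f|%N %| coef_prod H)%N.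
Proof.
move=> fH c0; rewrite coef_prodE (big_rem f) //= ifN ?dvdn_mulr //.
by rewrite absz_eq0.
Qed.

(* Away from the zeros of the forms, a translation by a multiple of [M] brings [y] closer
   to a zero of [f0] without changing any sign. *)
Lemma translate_near_zero (M : nat) (H : seq affine) (f0 : affine) (x : seq int) (y : int) :
    (0 < M)%N -> f0 \in H -> coef f0 != 0 ->
  exists f y', [/\ f \in H, coef f != 0, (M %| y - y')%Z,
    `|eval f (y' :: x)| <= `|coef f| * M%:Z &
    forall g, g \in H -> (eval g (y :: x) <= 0) = (eval g (y' :: x) <= 0)].
Proof.
move=> M0 f0H c0.
elim/ltn_ind: {y}`|eval f0 (y :: x)|%N {-2}y (erefl `|eval f0 (y :: x)|%N) => n IHn y yn.
have [/hasP[f fH /andP[cf fy]]|/hasPn far] := boolP (has (fun f =>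
    (coef f != 0) && (`|eval f (y :: x)| <= `|coef f| * M%:Z)) H).
  by exists f, y; split=> //; rewrite subrr dvdz0.
have {}far g : g \in H -> coef g != 0 -> `|coef g| * M%:Z < `|eval g (y :: x)|.
  by move=> gH cg; have := far g gH; rewrite cg /= ltNge.
(* The shift [s] moves [y] towards the zero of [f0]. Every form with nonzero coefficient exceeds
   [|coef g| * M] in absolute value, so it keeps its sign, and the value of [f0] shrinks. *)
pose s : int := if (0 < eval f0 (y :: x)) == (0 < coef f0) then - M%:Z else M%:Z.
have sM : s = M%:Z \/ s = - M%:Z by rewrite /s; case: ifP; [right|left].
have evs g : eval g (y + s :: x) = eval g (y :: x) + coef g * s by rewrite !eval_coef; ring.
have [] := IHn _ _ (y + s) erefl.
  have := far f0 f0H c0; rewrite -yn evs /s.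
  by case: ifP; case: (ltrP 0 (coef f0)); case: (ltrP 0 (eval f0 (y :: x))) => //=; nia.
move=> f [y' [fH cf dy hy hg]]; exists f, y'; split=> // [|g gH].
  have -> : y - y' = (y + s - y') - s by ring.
  by rewrite rpredB // dvdzE; case: sM => ->; rewrite ?abszN.
rewrite -hg // evs; have [->|cg] := eqVneq (coef g) 0; first by rewrite mul0r addr0.
by have := far g gH cg; case: sM => ->; nia.
Qed.

(** Either [w] and [w'] lie on the same side of the window from [-B] to [B], where [u] cannot change
    the sign, or both lie inside it and congruence modulo [N > 2 * B] makes them equal. *)
Lemma shift_sign (w w' u B N : int) :
    `|u| <= B -> (N %| w - w')%Z -> 2 * B < N ->
    (w + B <= 0) = (w' + B <= 0) -> (w - B <= 0) = (w' - B <= 0) ->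
  (w + u <= 0) = (w' + u <= 0).
Proof.
move=> uB /dvdzP[q wq] BN; case: (lerP (w + B)) => h1 /esym; case: (lerP (w' + B)) => //= h1' _;
  case: (lerP (w - B)) => h2 /esym; case: (lerP (w' - B)) => //= h2' _; try by lia.
suff -> : w = w' by [].
have : q = 0 by nia.
by move=> q0; move: wq; rewrite q0 mul0r; lia.
Qed.

Lemma abs_sgz (c : int) : `|c| = sgz c * c.
Proof. by case: (ltrgt0P c) => h; rewrite ?(gtr0_sgz h) ?(ltr0_sgz h) ?h ?sgz0; lia. Qed.

(** One round of the game: [y] is first brought near a zero of some [f], and the answer is the point
    at which [f] takes the same value over [x']. *)
Lemma agree_eliminate M H m x x' y : (0 < M)%N -> sized m.+1 H ->
  agree (eliminate (M, H)) x x' -> exists y', agree (M, H) (y :: x) (y' :: x').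
Proof.
move=> M0 hH [[sx dx] sim]; set P := coef_prod H.
have P0 : (0 < P)%N := coef_prod_gt0 H.
have M'E : (eliminate (M, H)).1 = (3 * M * (P * P))%N by [].
rewrite {}M'E in dx.
have {}sim L f : L \in samples [:: (M%:Z, 0); (- M%:Z, 0)] H -> f \in L ->
    (eval f x <= 0) = (eval f x' <= 0).
  by move=> hL fL; apply: sim; apply/flattenP; exists L.
have congr_cons y1 y2 : (M %| y1 - y2)%Z -> congr_mod M (y1 :: x) (y2 :: x').
  move=> dy; split=> [|[|i]] /=; [by rewrite sx|exact: dy|apply: dvdz_trans (dx i)].
  by rewrite dvdzE /= dvdn_mulr // dvdn_mull.
have [/hasP[f0 f0H c0]|/hasPn nocoef] := boolP (has (fun f => coef f != 0) H); last first.
  (* No form contains the eliminated variable, so [y] answers itself; the sample at -oo retains all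
     signs. *)
  exists y; split; first by apply: congr_cons; rewrite subrr dvdz0.
  move=> f fH; have /negPn/eqP cf := nocoef f fH.
  have := sim _ _ (samples_ninfty _ _) (map_f at_ninfty fH).
  by rewrite !eval_at_ninfty !eval_coef cf eqxx !mul0r !add0r.
have [f [y1 [fH cf dy1 hy1 hy]]] := translate_near_zero x y M0 f0H c0.
set c := coef f in cf hy1.
have /dvdnP[k kP] := dvdn_coef_prod fH cf; rewrite -/P -/c in kP.
have /dvdzP[q qE] : ((3 * M * (P * P))%N %| eval (rest f) x - eval (rest f) x')%Z.
  have -> : eval (rest f) x - eval (rest f) x' = dot (rest f).2 x - dot (rest f).2 x'.
    by rewrite /eval; ring.
  exact: dot_congr (conj sx dx).
have PE : P%:Z = k%:Z * (sgz c * c) by rewrite -abs_sgz kP PoszM abszE.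
(* Solution of [c * y2 + eval (rest f) x' = c * y1 + eval (rest f) x]: the rests differ by
   [q * 3 * M * P * P], and [P] is [k] times [|c|], so [y2] is an integer and congruent to [y1]
   modulo [M]. *)
pose y2 := y1 + q * 3 * M%:Z * P%:Z * k%:Z * sgz c.
have yE : c * y2 + eval (rest f) x' = c * y1 + eval (rest f) x.
  have -> : eval (rest f) x = eval (rest f) x' + q * (3 * M%:Z * (P%:Z * P%:Z)).
    by rewrite -!PoszM -qE; ring.
  by rewrite /y2 {2}PE; ring.
exists y2; split.
  apply: congr_cons; have -> : y - y2 = (y - y1) - q * 3 * M%:Z * P%:Z * k%:Z * sgz c.
    by rewrite /y2; ring.
  rewrite rpredB //.
  have -> : q * 3 * M%:Z * P%:Z * k%:Z * sgz c = (q * 3 * P%:Z * k%:Z * sgz c) * M%:Z by ring.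
  by rewrite dvdz_mull.
move=> g gH; rewrite hy // -(pmulr_rle0 (eval g (y1 :: x)) (_ : 0 < `|c|)) ?normr_gt0 //.
rewrite -(pmulr_rle0 (eval g (y2 :: x')) (_ : 0 < `|c|)) ?normr_gt0 //.
(* [W z] is [|c|] times the value of [g] at the zero of [f] over [z]; the samples translated by [M]
   and [- M] compare it with the two ends of a window. *)
pose W z := `|c| * eval (rest g) z - sgz c * coef g * eval (rest f) z.
have WE z y3 : `|c| * eval g (y3 :: z) = W z + sgz c * coef g * (c * y3 + eval (rest f) z).
  by rewrite eval_coef /W abs_sgz; ring.
rewrite !WE yE.
have szb : size (behead g.2) = size (behead f.2).
  by rewrite !size_behead (eqP (allP hH _ gH)) (eqP (allP hH _ fH)).
have simW t : t = M%:Z \/ t = - M%:Z ->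
    (W x + `|c| * coef g * t <= 0) = (W x' + `|c| * coef g * t <= 0).
  move=> ht; have tS : (t, 0) \in [:: (M%:Z, 0); (- M%:Z, 0 : int)].
    by case: ht => ->; rewrite !inE eqxx ?orbT.
  have := sim _ _ (samples_subst tS fH) (map_f _ gH).
  by rewrite /= !eval_subst // if_same !addr0.
(* The window has half-width at most [P * P * M], so the new modulus [3 * M * (P * P)] exceeds its
   width. *)
apply: (@shift_sign _ _ _ (`|c| * `|coef g| * M%:Z) (3 * M * (P * P))%N).
- rewrite !normrM; have := hy1; rewrite eval_coef -/c => hv.
  have -> : `|sgz c| = 1 by rewrite /sgz (negbTE cf); case: ifP.
  rewrite mul1r (_ : `|c| * `|coef g| * M%:Z = `|coef g| * (`|c| * M%:Z)); last by ring.
  exact: ler_wpM2l.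
- have -> : W x - W x' = `|c| * (dot (rest g).2 x - dot (rest g).2 x')
      - sgz c * coef g * (dot (rest f).2 x - dot (rest f).2 x') by rewrite /W /eval; ring.
  by apply: rpredB; rewrite dvdz_mull //; apply: dot_congr (conj sx dx).
- have cgP : (`|coef g| <= P)%N.
    have [->|cg] := eqVneq (coef g) 0; first by [].
    by apply: dvdn_leq => //; apply: dvdn_coef_prod.
  have cP : (`|c|%N <= P)%N by apply: dvdn_leq => //; apply: dvdn_coef_prod.
  rewrite -!abszE -!PoszM ltz_nat; have := leq_mul cP cgP.
  rewrite -(leq_pmul2r M0) => h; have : (0 < P * P * M)%N by rewrite !muln_gt0 P0.
  by lia.
all: have := simW M%:Z (or_introl erefl); have := simW (- M%:Z) (or_intror erefl).
all: case: (lerP 0 (coef g)) => cg.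
all: by rewrite ?(ger0_norm cg) ?(ltr0_norm cg) ?mulrN ?mulNr ?opprK.
Qed.

(** * Cells of an arrangement *)

Lemma exists_argmin (T : eqType) (key : T -> rat) (s : seq T) (x0 : T) : x0 \in s ->
  exists2 x, x \in s & forall y, y \in s -> key x <= key y.
Proof.
elim: s x0 => // x [|z s] IHs x0 _; first by exists x; rewrite ?inE // => y; rewrite inE => /eqP->.
have [w ws hw] := IHs z (mem_head _ _).
have [le|lt] := lerP (key x) (key w).
  exists x; rewrite ?mem_head // => y; rewrite inE => /orP[/eqP->//|/hw].
  exact: le_trans.
exists w; first by rewrite inE ws orbT.
by move=> y; rewrite inE => /orP[/eqP->|/hw//]; apply: ltW.
Qed.

(* The sample is the last zero before [y] among those of the forms, [y] included, and
   -oo if there is none. *)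
Lemma samples_cover m H x y : sized m.+1 H ->
  exists2 phi, [seq phi f | f <- H] \in samples [:: (0, 0); (0, 1)] H &
    forall f, f \in H -> (eval f (y :: x) <= 0) = (eval (phi f) x <= 0).
Proof.
move=> hH.
have szb f g : f \in H -> g \in H -> size (behead g.2) = size (behead f.2).
  by move=> fH gH; rewrite !size_behead (eqP (allP hH _ gH)) (eqP (allP hH _ fH)).
have substE e f g : f \in H -> g \in H -> eval (subst 0 e f g) x =
    `|coef f| * eval g (y :: x) - coef g * (sgz (coef f) * eval f (y :: x)) +
    (if 0 < coef g then e else 0).
  move=> fH gH; rewrite eval_subst ?(szb f g) // !eval_coef abs_sgz; ring.
(* If [y] is itself a zero of a form, the sample at that zero, with [e = 0], is exact. *)
have [/hasP[f fH /andP[cf /eqP f0]]|/hasPn no0] :=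
    boolP (has (fun f => (coef f != 0) && (eval f (y :: x) == 0)) H).
  exists (subst 0 0 f); first by apply: (@samples_subst _ _ (0, 0)); rewrite ?inE ?eqxx.
  move=> g gH; rewrite substE // f0 !mulr0 if_same subr0 addr0 pmulr_rle0 //.
  by rewrite normr_gt0.
have {}no0 f : f \in H -> coef f != 0 -> eval f (y :: x) != 0.
  by move=> fH cf; have := no0 f fH; rewrite cf.
(* The forms whose zero lies strictly below [y]. *)
pose B := [seq f <- H | 0 < sgz (coef f) * eval f (y :: x)].
have memB f : f \in H -> (f \in B) = (0 < sgz (coef f) * eval f (y :: x)).
  by move=> fH; rewrite mem_filter fH andbT.
have [/hasP[f0 f0B _]|/hasPn B0] := boolP (has predT B).
  (* The distance from [y] to the zero of [f]. *)
  pose key f : rat := (`|eval f (y :: x)|)%:~R / (`|coef f|)%:~R.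
  have [f fB hf] := exists_argmin key f0B.
  have fH : f \in H by move: fB; rewrite mem_filter => /andP[].
  have f_gt0 : 0 < sgz (coef f) * eval f (y :: x) by rewrite -memB.
  have cf : coef f != 0 by apply: contraTneq f_gt0 => ->; rewrite sgz0 mul0r ltxx.
  have {}hf g : g \in B ->
      `|eval f (y :: x)| * `|coef g| <= `|eval g (y :: x)| * `|coef f|.
    move=> gB; have := hf g gB.
    have cg : coef g != 0.
      move: gB; rewrite mem_filter => /andP[+ _].
      by apply: contraTneq => ->; rewrite sgz0 mul0r ltxx.
    rewrite /key ler_pdivrMr ?ltr0z ?normr_gt0 // mulrAC ler_pdivlMr ?ltr0z ?normr_gt0 //.
    by rewrite -!intrM ler_int.
  exists (subst 0 1 f); first by apply: (@samples_subst _ _ (0, 1)); rewrite ?inE ?eqxx ?orbT.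
  move=> g gH; rewrite substE //.
  have gB := memB g gH; have := hf g; rewrite gB {gB hf}.
  have := no0 g gH; have := no0 f fH cf; move: f_gt0 cf.
  move: (eval f _) (eval g _) (coef f) (coef g) => u v c d.
  have [c0|c0|->] := ltrgt0P c; rewrite ?(gtr0_sgz c0) ?(ltr0_sgz c0) ?sgz0 ?eqxx //;
  have [d0|d0|->] := ltrgt0P d; rewrite ?(gtr0_sgz d0) ?(ltr0_sgz d0) ?sgz0 //= => u0 _ u1 v1 h;
  rewrite ?mulN1r ?mul1r ?mul0r ?addr0 ?subr0 in u0 h *;
  (have uE : `|u| = (if 0 < u then u else - u) by case: ltrP; lia);
  (have vE : `|v| = (if 0 < v then v else - v) by case: ltrP; lia);
  rewrite uE vE in h; apply/idP/idP => hh; try nia.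
(* No zero lies at or below [y], so no sign changes between -oo and [y]. *)
exists at_ninfty; first exact: samples_ninfty.
move=> f fH; rewrite eval_at_ninfty; have [cf|cf] := eqVneq (coef f) 0.
  by rewrite eval_coef cf mul0r add0r.
have := no0 f fH cf; have : ~~ (0 < sgz (coef f) * eval f (y :: x)).
  by rewrite -memB //; apply/negP => /B0.
move: (eval f _) (coef f) cf => u c; have [c0|c0|->] := ltrgt0P c;
  rewrite ?(gtr0_sgz c0) ?(ltr0_sgz c0) ?eqxx //; lia.
Qed.

Lemma sized_refine_samples m Hs :
  all (sized m.+1) Hs -> all (sized m) (refine_samples Hs).
Proof.
move=> /allP h; apply/allP => L /flattenP[? /mapP[H HHs ->]].
by apply: (allP (sized_samples _ _)); apply: h.
Qed.

Lemma size_mem_refine_samples j H L : L \in iter j refine_samples [:: H] -> size L = size H.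
Proof.
elim: j L => [|j IHj] L /=; first by rewrite inE => /eqP->.
case/flattenP=> ? /mapP[H' /IHj <- ->] /mem_samples[->|[te [f [_ _ ->]]]];
  exact: size_map.
Qed.

(** [samples_cover] is applied to one coordinate after another; composing the maps [phi] keeps track
    of which form each entry of a sample comes from. *)
Lemma refine_samples_cover j m H x : sized (j + m) H -> size x = (j + m)%N ->
  exists2 phi, [seq phi f | f <- H] \in iter j refine_samples [:: H] &
    forall f, f \in H -> (eval f x <= 0) = (eval (phi f) (drop j x) <= 0).
Proof.
elim: j m => [|j IHj] m hH sx.
  by exists id; rewrite ?map_id ?inE // => f fH; rewrite drop0.
rewrite addSnnS in hH sx; have [phi phiI hphi] := IHj _ hH sx.
have sized_iter : all (sized m.+1) (iter j refine_samples [:: H]).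
  have : forall i, (i <= j)%N -> all (sized (j + m.+1 - i)) (iter i refine_samples [:: H]).
    elim=> [|i IHi] ij; first by rewrite subn0 /= hH.
    rewrite iterS; apply: sized_refine_samples.
    by have := IHi (ltnW ij); rewrite -subSn //; lia.
  by move/(_ j (leqnn j)); rewrite addKn.
have [psi psiI hpsi] :=
  @samples_cover m [seq phi f | f <- H] (drop j.+1 x) x`_j (allP sized_iter _ phiI).
exists (psi \o phi).
  rewrite iterS; apply/flattenP; exists (samples [:: (0, 0); (0, 1)] [seq phi f | f <- H]).
    exact: (map_f (samples [:: (0, 0); (0, 1)])).
  by move: psiI; rewrite -map_comp.
move=> f fH; rewrite hphi // (drop_nth 0) ?hpsi ?map_f // sx; lia.
Qed.

Lemma sized_iter_eliminate m j MH : sized (m + j) MH.2 -> sized m (iter j eliminate MH).2.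
Proof.
elim: j m => [|j IHj] m; first by rewrite addn0.
by rewrite addnS -addSn => /IHj h; rewrite iterS; apply: sized_eliminate.
Qed.

Lemma iter_eliminate_gt0 j MH : (0 < MH.1)%N -> (0 < (iter j eliminate MH).1)%N.
Proof.
move=> M0; elim: j => // j IHj.
have -> : (iter j.+1 eliminate MH).1 = (3 * (iter j eliminate MH).1 *
  (coef_prod (iter j eliminate MH).2 * coef_prod (iter j eliminate MH).2))%N by [].
by rewrite !muln_gt0 IHj coef_prod_gt0.
Qed.

(** A block is answered one variable at a time, the last eliminated one first. *)
Lemma agree_iter_eliminate n m MH x x' ys : (0 < MH.1)%N -> sized (m + n) MH.2 ->
    size ys = n -> agree (iter n eliminate MH) x x' ->
  exists2 ys', size ys' = n & agree MH (ys ++ x) (ys' ++ x').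
Proof.
elim: n MH ys => [|n IHn] MH ys M0 hH.
  by case: ys => // _ h; exists [::].
case: ys => // y ys [sys] h; rewrite iterSr in h.
have [||ys' sys' sim] := IHn (eliminate MH) ys _ _ sys h.
- exact: (@iter_eliminate_gt0 1).
- by apply: sized_eliminate; rewrite -addnS.
case: MH M0 hH {h} sim => M H M0 hH sim; rewrite addnS in hH.
have [y' sim'] := agree_eliminate y M0 hH sim.
by exists (y' :: ys') => //=; rewrite sys'.
Qed.

Lemma agree_sym MH x x' : agree MH x x' -> agree MH x' x.
Proof.
case=> [[sx dx] h]; split; last by move=> f fH; rewrite h.
by split=> // i; rewrite -opprB rpredN.
Qed.

(** * Presburger formulas as sets of signs *)

Lemma dot_cat (r r' x x' : seq int) : size r = size x ->
  dot (r ++ r') (x ++ x') = dot r x + dot r' x'.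
Proof. by elim: r x => [|c r IHr] [|y x] //= => [_|[/IHr ->]]; rewrite ?add0r ?addrA. Qed.

Lemma dot_rev (r x : seq int) : size r = size x -> dot (rev r) (rev x) = dot r x.
Proof.
elim: r x => [|c r IHr] [|y x] //= [rx].
by rewrite !rev_cons -!cats1 dot_cat ?size_rev // IHr //= addr0 addrC.
Qed.

Lemma dot_map (T : Type) (a x : T -> int) (l : seq T) :
  dot [seq a i | i <- l] [seq x i | i <- l] = \sum_(i <- l) a i * x i.
Proof. by elim: l => [|i l IHl]; rewrite ?big_nil ?big_cons //= IHl. Qed.

Definition coords (d : nat) (x : 'cV[int]_d) : seq int := [seq x i 0 | i <- enum 'I_d].

Lemma mulmx_dot (d : nat) (a : 'rV[int]_d) (x : 'cV[int]_d) :
  (a *m x) 0 0 = dot [seq a 0 j | j <- enum 'I_d] (coords x).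
Proof. by rewrite dot_map mxE big_enum. Qed.

Lemma size_coords (d : nat) (x : 'cV[int]_d) : size (coords x) = d.
Proof. by rewrite size_map size_enum_ord. Qed.

Lemma enc_mx_row (d : nat) (a : 'rV[int]_d) : enc_mx a = enc_ints [seq a 0 j | j <- enum 'I_d].
Proof.
rewrite /enc_mx /enc_ints -map_comp; congr flatten.
by rewrite enum_ordSl (size0nil (size_enum_ord 0)) /= cats0.
Qed.

Lemma enc_ints_cat s s' : enc_ints (s ++ s') = enc_ints s ++ enc_ints s'.
Proof. by rewrite /enc_ints map_cat flatten_cat. Qed.

Lemma enc_ints_flatten ss : enc_ints (flatten ss) = flatten [seq enc_ints s | s <- ss].
Proof. by elim: ss => //= s ss <-; rewrite enc_ints_cat. Qed.

Lemma read_form_enc (s : seq int) b r :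
  read_form (size s).+1 (enc_ints (rcons s b) ++ r) = ((- b, rev s), r).
Proof. by rewrite /read_form -(size_rcons s b) iter_push_int_enc cats0 rev_rcons. Qed.

Section Presburger.
Context (k : nat) (n : 'I_k.+1 -> nat).

(* The variables are listed from the innermost one to the outermost one. *)
Definition flat (l : seq 'I_k.+1) (v : valuation n) : seq int :=
  rev (flatten [seq coords (v i) | i <- l]).

Definition leq_coefs (a : forall i, 'rV[int]_(n i)) : seq int :=
  flatten [seq [seq a i 0 j | j <- enum 'I_(n i)] | i <- enum 'I_k.+1].

Fixpoint qf_forms (f : qf_formula n) : seq affine :=
  match f with
  | Leq a b => [:: (- b, rev (leq_coefs a))]
  | Not f => qf_forms f
  | And f g | Or f g => qf_forms f ++ qf_forms g
  end.

Definition dim_of (l : seq 'I_k.+1) : nat := sumn [seq n i | i <- l].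

Lemma flat_rcons l i v : flat (rcons l i) v = rev (coords (v i)) ++ flat l v.
Proof. by rewrite /flat map_rcons flatten_rcons rev_cat. Qed.

Lemma size_flat l v : size (flat l v) = dim_of l.
Proof.
rewrite size_rev size_flatten /dim_of; congr sumn; rewrite /shape -map_comp.
by apply: eq_map => i /=; rewrite size_coords.
Qed.

Lemma size_leq_coefs a : size (leq_coefs a) = dim_of (enum 'I_k.+1).
Proof.
rewrite size_flatten /dim_of; congr sumn; rewrite /shape -map_comp.
by apply: eq_map => i /=; rewrite size_map size_enum_ord.
Qed.

Lemma sized_qf_forms f : sized (dim_of (enum 'I_k.+1)) (qf_forms f).
Proof.
elim: f => [a b|f //|f IHf g IHg|f IHf g IHg].
- by rewrite /sized /= size_rev size_leq_coefs eqxx.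
- by rewrite /sized all_cat; apply/andP.
- by rewrite /sized all_cat; apply/andP.
Qed.

Lemma eval_leq a b v :
  eval (- b, rev (leq_coefs a)) (flat (enum 'I_k.+1) v) = \sum_i (a i *m v i) 0 0 - b.
Proof.
rewrite /eval /= /flat dot_rev; last first.
  by rewrite size_leq_coefs -(size_flat _ v) size_rev.
rewrite addrC; congr (_ - _); rewrite -big_enum /leq_coefs.
elim: (enum 'I_k.+1) => [|i l IHl] /=; first by rewrite big_nil.
by rewrite dot_cat ?size_map // IHl big_cons mulmx_dot.
Qed.

Lemma qf_holds_signs f v v' :
    (forall h, h \in qf_forms f ->
      (eval h (flat (enum 'I_k.+1) v) <= 0) = (eval h (flat (enum 'I_k.+1) v') <= 0)) ->
  qf_holds f v <-> qf_holds f v'.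
Proof.
elim: f => [a b h|f IHf h|f IHf g IHg h|f IHf g IHg h] /=.
- by have := h _ (mem_head _ _); rewrite !eval_leq !subr_le0 => ->.
- by have := IHf h; tauto.
- have hf : qf_holds f v <-> qf_holds f v' by apply: IHf => e he; apply: h; rewrite mem_cat he.
  have hg : qf_holds g v <-> qf_holds g v' by apply: IHg => e he; apply: h; rewrite mem_cat he orbT.
  by tauto.
- have hf : qf_holds f v <-> qf_holds f v' by apply: IHf => e he; apply: h; rewrite mem_cat he.
  have hg : qf_holds g v <-> qf_holds g v' by apply: IHg => e he; apply: h; rewrite mem_cat he orbT.
  by tauto.
Qed.

Lemma enc_qf_leq a b : enc_qf (@Leq k n a b) =
  [:: false; false] ++ enc_ints (rcons (leq_coefs a) b).
Proof.
have -> : enc_ints (rcons (leq_coefs a) b) = enc_ints (leq_coefs a) ++ enc_int b.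
  by rewrite -cats1 enc_ints_cat /enc_ints /= cats0.
congr [:: _, _ & _ ++ _].
rewrite /leq_coefs enc_ints_flatten -map_comp; congr flatten.
by apply: eq_map => i /=; rewrite enc_mx_row.
Qed.

Lemma iter_read_symbol_nil m N (H : seq affine) :
  iter m (read_symbol N) (H, [::]) = (H, [::]).
Proof. by elim: m => // m IHm; rewrite iterS IHm. Qed.

(** The encoding is prefix notation, so a left-to-right scan meets the inequalities in order without
    recursion. The bound on [m] lets the word itself serve as the clock. *)
Lemma iter_read_symbol (f : qf_formula n) (H : seq affine) r :
  exists2 m, (m <= size (enc_qf f))%N &
    iter m (read_symbol (dim_of (enum 'I_k.+1)).+1) (H, enc_qf f ++ r) =
    (rev (qf_forms f) ++ H, r).
Proof.
elim: f H r => [a b|f IHf|f IHf g IHg|f IHf g IHg] H r.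
- exists 1; first by [].
  have symbolE N w : iter 1 (read_symbol N) (H, [:: false, false & w]) =
      ((read_form N w).1 :: H, (read_form N w).2) by [].
  by rewrite enc_qf_leq -catA symbolE -(size_leq_coefs a) read_form_enc.
- have [m hm e] := IHf H r; exists m.+1; first by rewrite /= ltnW.
  by rewrite iterSr.
- have [m hm e] := IHf H (enc_qf g ++ r); have [p hp e'] := IHg (rev (qf_forms f) ++ H) r.
  exists (m.+1 + p)%N; first by rewrite /= size_cat; lia.
  rewrite addnC iterD iterSr /= -catA -[iter m _ _]/(iter m _ (H, enc_qf f ++ enc_qf g ++ r)).
  by rewrite e e' rev_cat catA.
- have [m hm e] := IHf H (enc_qf g ++ r); have [p hp e'] := IHg (rev (qf_forms f) ++ H) r.
  exists (m.+1 + p)%N; first by rewrite /= size_cat; lia.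
  rewrite addnC iterD iterSr /= -catA -[iter m _ _]/(iter m _ (H, enc_qf f ++ enc_qf g ++ r)).
  by rewrite e e' rev_cat catA.
Qed.

Lemma read_forms_enc (f : qf_formula n) :
  read_forms (dim_of (enum 'I_k.+1)).+1 (enc_qf f) = rev (qf_forms f).
Proof.
have [m hm e] := iter_read_symbol f [::] [::]; rewrite !cats0 in e.
by rewrite /read_forms foldl_iter -(subnK hm) iterD e iter_read_symbol_nil.
Qed.

Lemma flat_dfwith l i (v : valuation n) y : i \notin l -> flat l (dfwith v i y) = flat l v.
Proof.
move=> il; rewrite /flat; congr (rev (flatten _)); apply/eq_in_map => j jl.
by rewrite dfwithout //; apply: contraNneq il => ->.
Qed.

Definition col_of (d : nat) (s : seq int) : 'cV[int]_d := \col_i nth 0 s i.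

Lemma nth_enum_ord_map (T : Type) (d : nat) (x0 : T) (s : seq T) : size s = d ->
  [seq nth x0 s i | i : 'I_d <- enum 'I_d] = s.
Proof.
move=> sd; rewrite -[RHS](mkseq_nth x0) /mkseq sd -(val_enum_ord d) -map_comp.
exact: eq_map.
Qed.

Lemma coords_col_of (d : nat) (s : seq int) : size s = d -> coords (col_of d s) = s.
Proof.
move=> sd; rewrite -[RHS](nth_enum_ord_map 0 sd) /coords; apply: eq_map => i.
by rewrite mxE.
Qed.

(** Answers in both directions transfer existential and universal statements alike. *)
Lemma quantify_iff (q : quantifier) (T : Type) (P P' : T -> Prop) :
    (forall y, exists y', P y <-> P' y') -> (forall y', exists y, P y <-> P' y') ->
  quantify q P <-> quantify q P'.
Proof.
move=> h h'; case: q; split=> /=.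
- by move=> Py y'; have [y [+ _]] := h' y'; apply.
- by move=> Py y; have [y' [_]] := h y; apply.
- by case=> y Py; have [y' [+ _]] := h y => /(_ Py); exists y'.
- by case=> y Py; have [y' [_]] := h' y => /(_ Py); exists y'.
Qed.

(** Induction on the quantifier prefix, outermost block first: once the blocks of [pre] are chosen,
    the points must agree for what is left after eliminating all later variables. *)
Lemma PA_holds_agree (F : PA n) (H : seq affine) :
    sized (dim_of (enum 'I_k.+1)) H -> {subset qf_forms (matrix_of F) <= H} ->
  forall pre (l : seq 'I_k) (v v' : valuation n),
    pre ++ [seq lift ord0 i | i <- l] = enum 'I_k.+1 ->
    agree (iter (dim_of [seq lift ord0 i | i <- l]) eliminate (1%N, H))
      (flat pre v) (flat pre v') ->
  let holds := foldr (fun (i : 'I_k) (P : valuation n -> Prop) (x : valuation n) =>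
           quantify (quant F i)
             (fun y : 'cV[int]_(n (lift ord0 i)) => P (dfwith x (lift ord0 i) y)))
        (qf_holds (matrix_of F)) l in
  holds v <-> holds v'.
Proof.
move=> hH subH pre l; elim: l pre => [|i l IHl] pre v v' /= epre sim.
  rewrite cats0 in epre; rewrite epre in sim.
  by apply: qf_holds_signs => h hf; apply: sim.2; apply: subH.
have ipre : lift ord0 i \notin pre.
  have := enum_uniq 'I_k.+1; rewrite -epre cat_uniq => /and3P[_ /hasPn hpre _].
  by apply: hpre; rewrite mem_head.
pose w := [seq lift ord0 j | j <- l].
have step u u' y :
    agree (iter (n (lift ord0 i) + dim_of w) eliminate (1%N, H)) (flat pre u) (flat pre u') ->
    exists y', agree (iter (dim_of w) eliminate (1%N, H))
      (flat (rcons pre (lift ord0 i)) (dfwith u (lift ord0 i) y))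
      (flat (rcons pre (lift ord0 i)) (dfwith u' (lift ord0 i) y')).
  rewrite iterD => simu.
  have [|||ys' sys' sim'] := @agree_iter_eliminate (n (lift ord0 i)) (dim_of pre)
    (iter (dim_of w) eliminate (1%N, H)) _ _ (rev (coords y)) _ _ _ simu.
  - exact: iter_eliminate_gt0.
  - apply: sized_iter_eliminate; rewrite /=.
    by move: hH; rewrite -epre /dim_of map_cat sumn_cat /= -/(dim_of w) addnA.
  - by rewrite size_rev size_coords.
  (* [flat] lists coordinates in reverse, so the answer is reversed back into a column. *)
  exists (col_of _ (rev ys')); rewrite !flat_rcons !flat_dfwith // !dfwithin.
  by rewrite coords_col_of ?size_rev // revK.
apply: quantify_iff => y.
  have [y' sim'] := step _ _ y sim; exists y'.
  by apply: (IHl (rcons pre (lift ord0 i))) => //; rewrite cat_rcons.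
have [y' sim'] := step _ _ y (agree_sym sim); exists y'.
by apply: iff_sym; apply: (IHl (rcons pre (lift ord0 i))) => //; rewrite cat_rcons.
Qed.

(** The modulus starts at 1 because the matrix depends on signs alone; the forms are reversed as
    [read_forms] produces them. *)
Lemma PA_set_agree (F : PA n) (x x' : 'cV[int]_(n ord0)) :
    agree (iter (dim_of [seq lift ord0 i | i <- enum 'I_k]) eliminate
      (1%N, rev (qf_forms (matrix_of F)))) (rev (coords x)) (rev (coords x')) ->
  PA_set F x <-> PA_set F x'.
Proof.
move=> sim; apply: (PA_holds_agree (H := rev (qf_forms (matrix_of F))) _ _ (pre := [:: ord0])).
- by rewrite /sized all_rev; apply: sized_qf_forms.
- by move=> h; rewrite mem_rev.
- by rewrite enum_ordSl.
- by rewrite /flat /= !cats0 !dfwithin.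
Qed.

End Presburger.

Local Open Scope classical_set_scope.
Local Open Scope ring_scope.

(** * The decomposition *)

Definition inequality_of (d : nat) (p : affine * affine) : 'rV[int]_d * int :=
  (\row_j nth 0 (cell_inequality p).1 j, (cell_inequality p).2).

(** A list [L] of constant forms prescribes the signs of the forms in [D.1.2]; all cells share the
    period [D.1.1] times the integer lattice. *)
Definition cells (d : nat) (D : nat * seq affine * seq (seq affine)) :
    seq (linear_system d * 'M[int]_d) :=
  [seq ([seq inequality_of d p | p <- zip D.1.2 L], (D.1.1%:Z)%:M) | L <- D.2].

Lemma size_cell_inequality (p : affine * affine) : size (cell_inequality p).1 = size p.1.2.
Proof. by rewrite /cell_inequality; case: ifP => _; rewrite /= ?size_map size_rev. Qed.

Lemma row_entries (d : nat) (s : seq int) : size s = d ->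
  [seq (\row_(j < d) nth 0 s j : 'rV[int]_d) 0 j | j <- enum 'I_d] = s.
Proof.
move=> sd; rewrite -[RHS](nth_enum_ord_map 0 sd); apply: eq_map => j.
by rewrite mxE.
Qed.

Lemma enc_mx_scalar d M : enc_mx ((M%:Z)%:M : 'M[int]_d) = enc_ints (scalar_entries d M).
Proof.
rewrite /enc_mx /enc_ints /scalar_entries; congr flatten.
rewrite -map_comp map_flatten -(val_enum_ord d); congr flatten.
rewrite -[RHS]map_comp -[RHS]map_comp; apply: eq_map => i /=.
rewrite -[RHS]map_comp -[RHS]map_comp; apply: eq_map => j /=.
by rewrite mxE -val_eqE /=; case: eqP.
Qed.

Lemma mem_zip1 (S T : eqType) (s : seq S) (t : seq T) p : p \in zip s t -> p.1 \in s.
Proof.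
elim: s t => [|x s IHs] [|y t] //=; rewrite !inE => /orP[/eqP->|/IHs ->]; rewrite ?eqxx ?orbT //.
Qed.

Lemma enc_decomposition_cells d D : sized d D.1.2 ->
  enc_decomposition (cells d D) = enc_cells d D.
Proof.
move=> hH; rewrite /enc_decomposition /enc_cells /cells /enc_seq -map_comp; congr (flatten _ ++ _).
apply: eq_map => L /=; congr (true :: _ ++ _); last exact: enc_mx_scalar.
congr (flatten _ ++ _); rewrite -map_comp; apply/eq_in_map => p /mem_zip1 pH /=.
congr cons; rewrite /enc_inequality /= enc_mx_row row_entries //.
by rewrite size_cell_inequality (eqP (allP hH _ pH)).
Qed.

Lemma mem_polyhedron (R : realType) d (S : linear_system d) (x : 'cV[int]_d) :
  polyhedron S (map_mx intr x : 'cV[R]_d) <-> forall c, c \in S -> (c.1 *m x) 0 0 <= c.2.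
Proof.
by split=> h c cS; move: (h c cS); rewrite -map_mxM [map_mx _ (_ *m _) _ _]mxE ler_int.
Qed.

Lemma inequality_ofP d (p : affine * affine) (x : 'cV[int]_d) : size p.1.2 = d ->
  ((inequality_of d p).1 *m x) 0 0 <= (inequality_of d p).2 <->
  (eval p.1 (rev (coords x)) <= 0) = (p.2.1 <= 0).
Proof.
move=> pd; rewrite mulmx_dot row_entries ?size_cell_inequality // /eval.
have -> : dot p.1.2 (rev (coords x)) = dot (rev p.1.2) (coords x).
  by rewrite -{1}[p.1.2]revK dot_rev // size_rev size_coords.
rewrite /inequality_of /cell_inequality; case: ifP => _ /=.
  by move: (dot _ _) => e; split=> h; [apply/idP; lia|lia].
have -> : dot [seq - c | c <- rev p.1.2] (coords x) = - dot (rev p.1.2) (coords x).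
  elim: (rev p.1.2) (coords x) => [|c r IHr] [|y z] /=; rewrite ?oppr0 //.
  by rewrite IHr; ring.
split=> h; first by apply/negbTE; lia.
by move/negbT: h; lia.
Qed.

Definition cell (d : nat) (H L : seq affine) : set 'cV[int]_d :=
  [set x | forall p, p \in zip H L -> (eval p.1 (rev (coords x)) <= 0) = (p.2.1 <= 0)].

Lemma polyhedron_cell (R : realType) d (H L : seq affine) (x : 'cV[int]_d) : sized d H ->
  polyhedron [seq inequality_of d p | p <- zip H L] (map_mx intr x : 'cV[R]_d) <-> cell H L x.
Proof.
move=> hH; split=> [/mem_polyhedron h p pH|h].
  apply/(inequality_ofP _ (eqP (allP hH _ (mem_zip1 pH)))); apply: h.
  exact: map_f.
apply/mem_polyhedron => _ /mapP[p pH ->].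
by apply/(inequality_ofP _ (eqP (allP hH _ (mem_zip1 pH)))); apply: h.
Qed.

Lemma congr_mod_map (T : Type) (M : nat) (a b : T -> int) (l : seq T) :
  (forall i, (M %| a i - b i)%Z) -> congr_mod M [seq a i | i <- l] [seq b i | i <- l].
Proof.
move=> h; elim: l => [|i l [sl dl]]; first by split=> // i; rewrite subrr dvdz0.
by split=> [|[|j]] /=; rewrite ?size_map //; apply: dl.
Qed.

Lemma cell_agree d (M : nat) (H L : seq affine) (x x' : 'cV[int]_d) : size L = size H ->
    (forall i, (M %| (x i 0 - x' i 0)%R)%Z) -> cell H L x -> cell H L x' ->
  agree (M, H) (rev (coords x)) (rev (coords x')).
Proof.
move=> sL dx hx hx'; split=> [|f fH].
  by rewrite -!map_rev; apply: congr_mod_map.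
have : f \in unzip1 (zip H L) by rewrite unzip1_zip // sL.
by case/mapP=> p pH ->; rewrite hx // hx'.
Qed.

Lemma lattice_scalar d (M : nat) (v : 'cV[int]_d) :
  lattice ((M%:Z)%:M) v <-> forall i, (M %| (v i 0)%R)%Z.
Proof.
split=> [[z _ <-] i|h]; first by rewrite mul_scalar_mx mxE dvdz_mulr.
exists (\col_i ((v i 0)%R %/ M)%Z) => //; apply/colP => i; rewrite mul_scalar_mx !mxE.
by rewrite mulrC divzK.
Qed.

(** For positive [M] the type ['I_M.-1.+1] is ['I_M], in the shape that [inord] needs. *)
Definition residues (d M : nat) : seq 'cV[int]_d :=
  [seq \col_i (f i : nat)%:Z | f : {ffun 'I_d -> 'I_M.-1.+1}].

Lemma residuesP d (M : nat) (x : 'cV[int]_d) : (0 < M)%N ->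
  exists2 c, c \in residues d M & lattice ((M%:Z)%:M) (x - c).
Proof.
move=> M0; pose f := [ffun i : 'I_d => inord `|((x i 0)%R %% M)%Z|%N : 'I_M.-1.+1].
exists (\col_i (f i : nat)%:Z); first by apply/mapP; exists f; rewrite ?mem_enum.
apply/lattice_scalar => i; rewrite !mxE ffunE inordK; last first.
  by rewrite prednK // -ltz_nat gez0_abs ?modz_ge0 ?ltz_pmod //; lia.
rewrite gez0_abs ?modz_ge0 //; last by lia.
by rewrite {1}(divz_eq (x i 0) M) addrK dvdz_mull.
Qed.

(* A cell is only used for the points that no earlier cell contains: the enumeration of
   the cells may repeat itself. *)
Lemma patterned_decomposition_cells (R : realType) d (M : nat) (H : seq affine)
    (X : set 'cV[int]_d) :
    (0 < M)%N -> sized d H ->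
    (forall x x', agree (M, H) (rev (coords x)) (rev (coords x')) -> X x <-> X x') ->
  patterned_decomposition R X (cells d (M, H, iter d refine_samples [:: H])).
Proof.
move=> M0 hH hX; set Hs := iter d refine_samples [:: H]; set D := cells _ _.
have sD : size D = size Hs by rewrite size_map.
pose L (i : nat) := nth [::] Hs i.
have sL i : (i < size Hs)%N -> size (L i) = size H.
  by move=> ?; apply: (@size_mem_refine_samples d); apply: mem_nth.
have tnthD (j : 'I_(size D)) : tnth (in_tuple D) j =
    ([seq inequality_of d p | p <- zip H (L j)], (M%:Z)%:M).
  by rewrite (tnth_nth ([::], 0)) /= (nth_map [::]) // -sD.
split=> [j|]; first by rewrite tnthD /= det_scalar expf_neq0 //; lia.
(* A good point shows that the coset of [c] belongs to the pattern of cell [j]: it lies in [X], in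
   this cell and in no earlier one. *)
pose good (j : nat) (c x : 'cV[int]_d) := [/\ X x, cell H (L j) x,
  lattice ((M%:Z)%:M) (x - c) & forall i, (i < j)%N -> ~ cell H (L i) x].
pose reps (j : nat) := [seq c <- residues d M | `[< exists x, good j c x >]].
pose T (j : 'I_(size D)) := \bigcup_(c in [set` reps j])
  [set c + v | v in lattice ((M%:Z)%:M)].
(* One good point suffices for its coset: points of one cell congruent modulo [M] agree, which
   preserves [X] and membership in the earlier cells. *)
have goodT (j : 'I_(size D)) x : T j x -> cell H (L j) x ->
    X x /\ forall i, (i < j)%N -> ~ cell H (L i) x.
  case=> c; rewrite /= mem_filter => /andP[/asboolP[x0 [Xx0 cx0 lx0 nx0]] _] [v lv vx] cx.
  have ltj : (j < size Hs)%N by rewrite -sD.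
  have dx i : (M %| (x i 0 - x0 i 0)%R)%Z.
    move/lattice_scalar/(_ i): lx0; move/lattice_scalar/(_ i): lv; rewrite -vx !mxE => lv lx0.
    have -> : c i 0 + v i 0 - x0 i 0 = v i 0 - (x0 i 0 - c i 0) by ring.
    exact: rpredB.
  have ag := cell_agree (sL _ ltj) dx cx cx0.
  split=> [|i ij cix]; first by apply/(hX _ _ ag).
  have lti : (i < size Hs)%N by apply: ltn_trans ltj.
  by apply: (nx0 i ij) => p pH; rewrite -cix // (ag.2 _ (mem_zip1 pH)).
have Tgood (j : 'I_(size D)) x : X x -> cell H (L j) x ->
    (forall i, (i < j)%N -> ~ cell H (L i) x) -> T j x.
  move=> Xx cx nx; have [c cr lc] := residuesP x M0.
  exists c; first by rewrite /= mem_filter cr andbT; apply/asboolP; exists x.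
  by exists (x - c) => //; rewrite addrC subrK.
exists T; split.
- move=> j; rewrite tnthD /=; by exists (reps j).
- apply/trivIsetP => i j _ _ ij; apply/seteqP; split=> // x [].
  rewrite /patterned_polyhedron !tnthD /= => -[/(polyhedron_cell _ _ _ hH) ci Ti]
    [/(polyhedron_cell _ _ _ hH) cj Tj].
  have [_ ni] := goodT _ _ Ti ci; have [_ nj] := goodT _ _ Tj cj.
  case: (ltngtP i j) => [/nj|/ni|/val_inj e]; [exact|exact|].
  by rewrite e eqxx in ij.
- apply/seteqP; split=> x; last first.
    case=> j _ []; rewrite tnthD /= => /(polyhedron_cell _ _ _ hH) cx Tx.
    by have [] := goodT j x Tx cx.
  move=> Xx.
  (* With [m = 0] every coordinate is consumed: the images under [phi] act as constants recording
     the signs of [H] at [x]. *)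
  have := @refine_samples_cover d 0 H (rev (coords x)); rewrite addn0.
  move=> /(_ hH (etrans (size_rev _) (size_coords x))) [phi phiI hphi].
  have ex_cell : exists i, `[< (i < size Hs)%N /\ cell H (L i) x >].
    exists (index [seq phi f | f <- H] Hs); apply/asboolP; rewrite index_mem phiI; split=> //.
    rewrite /L nth_index // => p.
    have -> : zip H [seq phi f | f <- H] = [seq (f, phi f) | f <- H].
      by elim: (H) => //= f r ->.
    case/mapP=> f fH -> /=.
    by rewrite hphi // drop_oversize ?size_rev ?size_coords // /eval; case: (phi f) => b [|c r];
      rewrite /= addr0.
  case: (ex_minnP ex_cell) => i /asboolP[ltj cx] mini.
  rewrite -sD in ltj; exists (Ordinal ltj) => //; rewrite /patterned_polyhedron tnthD /=.
  split; first exact/(polyhedron_cell _ _ _ hH).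
  apply: Tgood => // i' lti' cx'; have lt_i : (i' < i)%N := lti'.
  have : (i <= i')%N by apply/mini/asboolP; split=> //; rewrite -sD; exact: ltn_trans lt_i ltj.
  by rewrite leqNgt lt_i.
Qed.

(** * Words as input and output *)

(** Turns a raw word into the code of a list of bits: each [b] becomes [true], [b], [false]. *)
Definition load_prog (k : nat) : program :=
  Seq (move (k + 0) (k + 1))
    (drain (k + 1) (fun b => Seq (Push (k + 0) false) (Seq (Push (k + 0) b) (Push (k + 0) true)))).

Lemma run_load k s (w : seq bool) :
  run (load_prog k) (st k s [:: w]) (10 * size w + 2)%N (st k s [:: encode w]).
Proof.
run_start.
- run_step (@st_move k s [:: w] 0 1 isT).
  have := @run_drain (k + 1)
    (fun b => Seq (Push (k + 0) false) (Seq (Push (k + 0) b) (Push (k + 0) true)))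
    3 (fun u v => st k s [:: encode u; v]) _ _ (rev w) [::].
  apply; last by move=> u v; rewrite st_at.
  move=> u b v; rewrite upd_st /=; apply: (@run_leq _ _ (1 + (1 + 1))%N) => //.
  by run_step (@st_push k s [:: encode u; v] 0 false);
     run_step (@st_push k s [:: false :: encode u; v] 0 b);
     exact: (@st_push k s [:: [:: b, false & encode u]; v] 0 true).
- by rewrite /= size_rev; lia.
- by rewrite catrevE revK cats0; st_trim.
Qed.

Definition unload_loop (k : nat) : program :=
  While (k + 0) (Seq (Pop (k + 0)) (Seq
    (Switch (k + 0) Skip (Seq (Pop (k + 0)) (Push (k + 1) false))
                         (Seq (Pop (k + 0)) (Push (k + 1) true))) (Pop (k + 0)))).

Lemma run_unload_loop k s (w u : seq bool) :
  run (unload_loop k) (st k s [:: encode w; u]) (6 * size w + 1)%N (st k s [:: [::]; rev w ++ u]).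
Proof.
elim: w u => [|b w IHw] u.
  by apply: (@run_while_done _ _ (st k s [:: [::]; u])); rewrite st_at.
apply: (@run_leq _ _ ((1 + ((1 + 1).+1 + 1)) + (6 * size w + 1)).+1)%N; last by rewrite /=; lia.
rewrite rev_cons cat_rcons; apply: run_while (IHw (b :: u)); first by rewrite st_at.
run_step (@st_pop k s [:: encode (b :: w); u] 0).
apply: (@run_seq _ _ _ _ (st k s [:: false :: encode w; b :: u])); last first.
  exact: (@st_pop k s [:: false :: encode w; b :: u] 0).
apply: (@run_leq _ _ (1 + 1)%N.+1) => //; apply: run_switch; rewrite st_at /=.
case: b.
  run_step (@st_pop k s [:: [:: true, false & encode w]; u] 0).
  exact: (@st_push k s [:: false :: encode w; u] 1).
run_step (@st_pop k s [:: [:: false, false & encode w]; u] 0).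
exact: (@st_push k s [:: false :: encode w; u] 1).
Qed.

Definition unload_prog (k : nat) : program := Seq (unload_loop k) (move (k + 1) (k + 0)).

Lemma run_unload k s (w : seq bool) :
  run (unload_prog k) (st k s [:: encode w]) (10 * size w + 2)%N (st k s [:: w]).
Proof.
run_start.
- rewrite (_ : st k s [:: encode w] = st k s [:: encode w; [::]]); last by st_trim.
  run_step (run_unload_loop k s w [::]).
  exact: (@st_move k s [:: [::]; rev w] 1 0 isT).
- by rewrite /= size_rev; lia.
- by rewrite /= revK cats0; st_trim.
Qed.

Lemma found_in_poly_time_ptime (I O : Type) (encI : I -> seq bool) (encO : O -> seq bool)
    (spec : I -> O -> Prop) (f : seq bool -> seq bool) :
    ptime f -> (forall x, exists2 y, f (encI x) = encO y & spec x y) ->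
  found_in_poly_time (fun x => size (encI x)) encI encO spec.
Proof.
move=> fP hf; have fs := ptime_esize fP; case: fP => p [T [Tp hp]].
have [c hc] : pbounded (fun w : seq bool => 10 * esize w + 2 + (T w + (10 * esize (f w) + 2)))%N.
  by pbound.
(* The code of a word is three times as long as the word, and [pbounded] takes powers of the code
   length plus 2. *)
exists (Seq (load_prog 0) (Seq (p 0%N) (unload_prog 0))), ((3%N%:P * 'X + 2%N%:P) ^+ c) => x.
have [y fy spxy] := hf x; set w := encI x in fy *.
have [t tle e] := run_seq (run_load 0 (fun=> [::]) w)
  (run_seq (hp w 0%N (fun=> [::])) (run_unload 0 (fun=> [::]) (f w))).
exists y, t; split=> //.
  exists (st 0 (fun=> [::]) [:: f w]); last by rewrite fy.
  have <- : st 0 (fun=> [::]) [:: w] = [eta fun=> [::] with 0%N |-> w].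
    by apply: funext => -[|i]; rewrite /st //= nth_nil.
  exact: e.
apply: leq_trans tle _; rewrite horner_exp hornerD hornerCM hornerX hornerC.
have := hc w; rewrite !esize_bits.
have -> : ((3%N * size w + 2%N)%R ^+ c = (3 * size w + 2) ^ c)%N by [].
by rewrite [(3 * size w + 2)%N]addn2; lia.
Qed.

Lemma iter_behead (T : Type) j (s : seq T) : iter j behead s = drop j s.
Proof. by elim: j s => [|j IHj] s; rewrite ?drop0 // iterSr IHj; case: s. Qed.

(** The first [k] bits are the quantifiers; they influence only the patterns, so the computation
    skips them. *)
Definition presburger_cells (k N Q d : nat) (w : seq bool) :
    nat * seq affine * seq (seq affine) :=
  let MH := iter Q eliminate (1%N, read_forms N.+1 (iter k behead w)) in
  (MH, iter d refine_samples [:: MH.2]).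

Lemma ptime_presburger_cells k N Q d :
  ptime (fun w => enc_cells d (presburger_cells k N Q d w)).
Proof.
have mhP : ptime (fun w => iter Q eliminate (1%N, read_forms N.+1 (iter k behead w))).
  apply: ptime_iter; first by apply: ptime_eliminate; ptime_tac.
  apply: ptime_pair; first exact: ptime_const.
  apply: ptime_read_forms; apply: ptime_iter; last exact: ptime_id.
  exact: (ptime_behead ptime_id).
apply: ptime_enc_cells; apply: ptime_pair => //.
apply: ptime_iter; first by apply: ptime_refine_samples; ptime_tac.
by ptime_tac.
Qed.

Theorem theorem5p2 (R : realType) (k : nat) (n : 'I_k.+1 -> nat)
    (hn : forall i, (0 < n i)%N) :
  found_in_poly_time (@PA_length k n) (@enc_PA k n)
    (@enc_decomposition (n ord0))
    (fun (F : PA n) (D : seq (linear_system (n ord0) * 'M[int]_(n ord0))) =>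
       patterned_decomposition R (PA_set F) D).
Proof.
pose N := dim_of n (enum 'I_k.+1); pose Q := dim_of n [seq lift ord0 i | i <- enum 'I_k].
(* Eliminating the [Q] bound variables will leave forms in the [n ord0] free ones. *)
have NE : N = (n ord0 + Q)%N by rewrite /N enum_ordSl.
apply: (found_in_poly_time_ptime (ptime_presburger_cells k N Q (n ord0))) => F.
have -> : presburger_cells k N Q (n ord0) (enc_PA F) =
    (iter Q eliminate (1%N, rev (qf_forms (matrix_of F))),
     iter (n ord0) refine_samples [:: (iter Q eliminate (1%N, rev (qf_forms (matrix_of F)))).2]).
  rewrite /presburger_cells iter_behead /enc_PA drop_size_cat ?read_forms_enc //.
  by rewrite size_map size_enum_ord.
have hH : sized (n ord0) (iter Q eliminate (1%N, rev (qf_forms (matrix_of F)))).2.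
  by apply: sized_iter_eliminate; rewrite -NE /sized all_rev; apply: sized_qf_forms.
have M0 := @iter_eliminate_gt0 Q (1%N, rev (qf_forms (matrix_of F))) isT.
have hX := @PA_set_agree _ _ F; rewrite -/Q in hX.
case: (iter Q eliminate _) hH M0 hX => M H hH M0 hX.
exists (cells (n ord0) (M, H, iter (n ord0) refine_samples [:: H])).
  by rewrite enc_decomposition_cells.
exact: patterned_decomposition_cells.
Qed.
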